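(* Let $a\ge 0$. There is a constant $M\ge 0$, independent of $f$ and of $M_{n_1,n_2}(x,y)$, such that for every $f\in C_B(I)$, all $(x,y)\in I$ and all $n_1,n_2\in\mathbb{N}$, $$|K_{n_1,n_2}^a(f;x,y)-f(x,y)|\le 4\,\mathcal{K}\big(f;M_{n_1,n_2}(x,y)\big)+\omega\big(f;\rho_{n_1,n_2}(x,y)\big)$$ $$\le M\Big\{\omega_2\big(f;\sqrt{M_{n_1,n_2}(x,y)}\big)+\min\{1,M_{n_1,n_2}(x,y)\}\,\|f\|_{C_B(I)}\Big\}+\omega\big(f;\rho_{n_1,n_2}(x,y)\big),$$ where $$\rho_{n_1,n_2}(x,y)=\sqrt{\Big(\frac{1}{n_1+1}\Big(-x+\frac{ax}{1+x}+\frac12\Big)\Big)^2+\Big(\frac{1}{n_2+1}\Big(-y+\frac{ay}{1+y}+\frac12\Big)\Big)^2}$$ and $$M_{n_1,n_2}(x,y)=\frac{\{\delta_{n_1}^a(x)\}^2}{n_1+1}+\frac{\{\delta_{n_2}^a(y)\}^2}{n_2+1}.$$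
   Context: $I=[0,\infty)\times[0,\infty)$, $\mathbb{N}=\{1,2,\dots\}$, $a\ge0$ is a fixed real parameter; functions are real-valued. Operators: let $(n)_0=1$, $(n)_i=n(n+1)\cdots(n+i-1)$ for $i\ge1$, $P_k(n,a)=\sum_{i=0}^{k}\binom{k}{i}(n)_i a^{k-i}$, and $$W_{n,k}^a(x)=e^{-\frac{ax}{1+x}}\frac{P_k(n,a)}{k!}\frac{x^k}{(1+x)^{n+k}},\qquad x\ge0,$$ (with $x^0=1$). Put $W^a_{n_1,n_2,k_1,k_2}(x,y)=W^a_{n_1,k_1}(x)W^a_{n_2,k_2}(y)$ and $$K_{n_1,n_2}^a(f;x,y)=(n_1+1)(n_2+1)\sum_{k_1=0}^\infty\sum_{k_2=0}^\infty W^a_{n_1,n_2,k_1,k_2}(x,y)\int_{\frac{k_2}{n_2+1}}^{\frac{k_2+1}{n_2+1}}\int_{\frac{k_1}{n_1+1}}^{\frac{k_1+1}{n_1+1}}f(u,v)\,du\,dv .$$ For $x\ge 0$, $\delta_n^a(x)\geq 0$ is defined by $\{\delta_n^a(x)\}^2=x(1+x)+\frac{(1+a)^2}{n+1}$. $C_B(I)$ is the space of all bounded uniformly continuous functions on $I$, with sup norm $\|\cdot\|_{C_B(I)}$. $C_B^2(I)$ is the set of $f\in C_B(I)$ whose partial derivatives $f^{(p,q)}=\partial^{p+q}f/\partial x^p\partial y^q$ belong to $C_B(I)$ for $0\le p,q\le2$, with norm $$\|f\|_{C_B^2(I)}=\|f\|_{C_B(I)}+\sum_{i=1}^2\Big\|\frac{\partial^i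 f}{\partial x^i}\Big\|_{C_B(I)}+\sum_{i=1}^2\Big\|\frac{\partial^i f}{\partial y^i}\Big\|_{C_B(I)}.$$ Peetre's $K$-functional: $\mathcal{K}(f;\delta)=\inf_{g\in C_B^2(I)}\{\|f-g\|_{C_B(I)}+\delta\|g\|_{C_B^2(I)}\}$ for $\delta>0$. Complete modulus of continuity: $\omega(f;\delta)=\sup\{|f(u,v)-f(x,y)|:(u,v),(x,y)\in I,\ \sqrt{(u-x)^2+(v-y)^2}\le\delta\}$. Second order modulus of continuity: $\omega_2(f;\delta)=\sup|f(x+2h,y+2k)-2f(x+h,y+k)+f(x,y)|$, the supremum over all $(x,y)\in I$ and $(h,k)\in\mathbb{R}^2$ with $0<\sqrt{h^2+k^2}\le\delta$ and $(x+2h,y+2k)\in I$. *)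

(* Defs.v *)
(* Stdlib reals with Coquelicot. *)
From Stdlib Require Import Reals.
From Coquelicot Require Import Coquelicot.
Open Scope R_scope.

(* A real function on I = [0,oo) x [0,oo) is represented by a total function
   R -> R -> R; every notion below depends only on its values on I. *)
Definition inI (x y : R) : Prop := 0 <= x /\ 0 <= y.

(* Supremum and infimum of a set of reals. They are the usual ones when the set
   is nonempty and bounded (above, resp. below), as it is in all uses below when
   the functions involved are in CB (in CB2 for normCB2) and delta > 0
   (delta >= 0 for omega); an infinite supremum or infimum would give 0. *)
Definition supR (E : R -> Prop) : R := real (Lub_Rbar E).
Definition infR (E : R -> Prop) : R := real (Glb_Rbar E).

Fixpoint pochhammer (n i : nat) : R :=
  match i with
  | O => 1
  | S j => pochhammer n j * INR (n + j)
  end.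

Definition Ppoly (k n : nat) (a : R) : R :=
  sum_f_R0 (fun i => Binomial.C k i * pochhammer n i * a ^ (k - i)) k.

Definition W (a : R) (n k : nat) (x : R) : R :=
  exp (- (a * x / (1 + x))) * (Ppoly k n a / INR (Factorial.fact k))
  * (x ^ k / (1 + x) ^ (n + k)).

Definition node (n k : nat) : R := INR k / INR (n + 1).

Definition Kant (a : R) (n1 n2 : nat) (f : R -> R -> R) (x y : R) : R :=
  INR (n1 + 1) * INR (n2 + 1) *
  Series (fun k1 => Series (fun k2 =>
    W a n1 k1 x * W a n2 k2 y *
    RInt (fun v => RInt (fun u => f u v) (node n1 k1) (node n1 (k1 + 1)))
         (node n2 k2) (node n2 (k2 + 1)))).

Definition delta (a : R) (n : nat) (x : R) : R :=
  sqrt (x * (1 + x) + (1 + a) ^ 2 / INR (n + 1)).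

Definition bounded_on_I (f : R -> R -> R) : Prop :=
  exists B, forall x y, inI x y -> Rabs (f x y) <= B.

Definition unif_cont_on_I (f : R -> R -> R) : Prop :=
  forall eps, 0 < eps -> exists eta, 0 < eta /\
    forall u v x y, inI u v -> inI x y ->
      sqrt ((u - x) ^ 2 + (v - y) ^ 2) < eta -> Rabs (f u v - f x y) < eps.

Definition CB (f : R -> R -> R) : Prop := bounded_on_I f /\ unif_cont_on_I f.

Definition normCB (f : R -> R -> R) : R :=
  supR (fun r => exists x y, inI x y /\ r = Rabs (f x y)).

(* Differentiation relative to [0,oo): one-sided at 0, two-sided elsewhere. *)
Definition is_deriv_nonneg (f : R -> R) (x l : R) : Prop :=
  D_in f (fun _ => l) (fun t => 0 <= t) x.

Definition ex_deriv_nonneg (f : R -> R) (x : R) : Prop :=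
  exists l, is_deriv_nonneg f x l.

(* Meaningful under ex_deriv_nonneg, which is required separately in CB2. *)
Definition deriv_nonneg (f : R -> R) (x : R) : R :=
  iota (fun l : R => is_deriv_nonneg f x l).

Fixpoint deriv_nonneg_n (m : nat) (f : R -> R) : R -> R :=
  match m with
  | O => f
  | S m' => deriv_nonneg (deriv_nonneg_n m' f)
  end.

(* d^(p+q) g / dx^p dy^q: q times in y first, then p times in x. *)
Definition partialI (p q : nat) (g : R -> R -> R) (x y : R) : R :=
  deriv_nonneg_n p (fun u => deriv_nonneg_n q (fun v => g u v) y) x.

Definition CB2 (g : R -> R -> R) : Prop :=
  (forall q x y, (q < 2)%nat -> inI x y ->
     ex_deriv_nonneg (fun v => partialI 0 q g x v) y) /\
  (forall p q x y, (p < 2)%nat -> (q <= 2)%nat -> inI x y ->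
     ex_deriv_nonneg (fun u => partialI p q g u y) x) /\
  (forall p q, (p <= 2)%nat -> (q <= 2)%nat -> CB (partialI p q g)).

Definition normCB2 (g : R -> R -> R) : R :=
  normCB g
  + (normCB (partialI 1 0 g) + normCB (partialI 2 0 g))
  + (normCB (partialI 0 1 g) + normCB (partialI 0 2 g)).

Definition Kfunctional (f : R -> R -> R) (d : R) : R :=
  infR (fun r => exists g, CB2 g /\
    r = normCB (fun x y => f x y - g x y) + d * normCB2 g).

Definition omega (f : R -> R -> R) (d : R) : R :=
  supR (fun r => exists u v x y, inI u v /\ inI x y /\
    sqrt ((u - x) ^ 2 + (v - y) ^ 2) <= d /\ r = Rabs (f u v - f x y)).

Definition omega2 (f : R -> R -> R) (d : R) : R :=
  supR (fun r => exists x y h k, inI x y /\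
    0 < sqrt (h ^ 2 + k ^ 2) <= d /\ inI (x + 2 * h) (y + 2 * k) /\
    r = Rabs (f (x + 2 * h) (y + 2 * k) - 2 * f (x + h) (y + k) + f x y)).

Definition rho (a : R) (n1 n2 : nat) (x y : R) : R :=
  sqrt ((1 / INR (n1 + 1) * (- x + a * x / (1 + x) + 1 / 2)) ^ 2
        + (1 / INR (n2 + 1) * (- y + a * y / (1 + y) + 1 / 2)) ^ 2).

Definition Mn (a : R) (n1 n2 : nat) (x y : R) : R :=
  delta a n1 x ^ 2 / INR (n1 + 1) + delta a n2 y ^ 2 / INR (n2 + 1).

(* Main.v *)
Require Import Defs.
From Stdlib Require Import Reals Lra Lia.
From Coquelicot Require Import Coquelicot.
Open Scope R_scope.

(** The Kantorovich operator is the expectation of [f (X, Y)] for independent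
    random variables [X], [Y]: pick [k] with the weights [W], then a uniform point
    of the [k]-th cell.  The weights are the convolution of a negative binomial
    and a Poisson law, so everything about them follows from the generating
    function [exp (a t) / (1 - t) ^ n] and two termwise derivatives of it
    ([W_first_moment], [W_second_factorial_moment]).  Consequently the mean of
    [X] is [x + 1 / (n + 1) * (- x + a x / (1 + x) + 1 / 2)] ([kant_mean_sub])
    and its variance is at most [delta ^ 2 / (n + 1)] ([kant_var_le]).

    First inequality.  The distance from [(x, y)] to the point of means
    [(m1, m2)] is exactly [rho], which gives the term [omega (f; rho)].  It
    remains to compare the expectation of [f (X, Y)] with [f (m1, m2)].  For [g]
    twice differentiable one first freezes [Y]: a Taylor expansion of [g] in its
    first variable about [m1] has a linear term of mean zero and a remainder
    controlled by [g_xx] and the variance of [X]; then one expands [g (m1, Y)]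
    about [m2].  Because of independence this never produces the mixed
    derivative, which the norm of C_B^2 does not control.  Replacing [f] by [g]
    costs at most [2 ||f - g||] ([Kant_estimate]); taking the infimum over [g]
    gives the K-functional.

    Second inequality.  For [d >= 1] compare with [g = 0].  For [d < 1] take for
    [g] a Steklov mean of [f] in each variable, with the combination
    [2 A_h^2 - A_(2h)^2] of averages over forward steps, where
    [A_h phi (x)] is the integral of [phi (x + h s)] over [0 <= s <= 1] and
    [2 h = sqrt d].  Only forward steps occur, so the quadrant is never left.
    Both the error [g - f] and [h ^ 2] times the pure second derivatives of [g]
    are combinations of averages of second differences of [f], hence bounded by
    [omega_2 (f; sqrt d)] ([steklov0_error], [steklov2_bound]); the first
    derivatives are interpolated between [g] and the second derivatives
    ([deriv_nonneg_landau]).  Altogether this is [Kfunctional_le_omega2]. *)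

(** * Suprema, infima and the norms *)

Lemma supR_upper (E : R -> Prop) (B r : R) :
  (forall s, E s -> s <= B) -> E r -> r <= supR E.
Proof.
  intros HB Hr. unfold supR. destruct (Lub_Rbar_correct E) as [H1 H2].
  assert (Hub : is_ub_Rbar E B) by (intros s Hs; apply HB, Hs).
  specialize (H1 r Hr). specialize (H2 B Hub).
  destruct (Lub_Rbar E); simpl in *; tauto.
Qed.

Lemma supR_least (E : R -> Prop) (B : R) :
  (exists r, E r) -> (forall s, E s -> s <= B) -> supR E <= B.
Proof.
  intros [r Hr] HB. unfold supR. destruct (Lub_Rbar_correct E) as [H1 H2].
  assert (Hub : is_ub_Rbar E B) by (intros s Hs; apply HB, Hs).
  specialize (H1 r Hr). specialize (H2 B Hub).
  destruct (Lub_Rbar E); simpl in *; tauto.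
Qed.

(** No boundedness is assumed: an empty or unbounded set gets the supremum 0,
    so norms and moduli are nonnegative for every function. *)
Lemma supR_nonneg (E : R -> Prop) : (forall s, E s -> 0 <= s) -> 0 <= supR E.
Proof.
  intros H. unfold supR. destruct (Lub_Rbar_correct E) as [H1 H2].
  destruct (Lub_Rbar E) as [l| |] eqn:EL; simpl; try lra.
  destruct (Rle_dec 0 l) as [Hl|Hl]; auto. exfalso.
  assert (H3 : Rbar_le l m_infty).
  { apply H2. intros s Hs. specialize (H1 s Hs). specialize (H s Hs). simpl in H1. lra. }
  exact H3.
Qed.

Lemma infR_lower (E : R -> Prop) (B r : R) :
  (forall s, E s -> B <= s) -> E r -> infR E <= r.
Proof.
  intros HB Hr. unfold infR. destruct (Glb_Rbar_correct E) as [H1 H2].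
  assert (Hlb : is_lb_Rbar E B) by (intros s Hs; apply HB, Hs).
  specialize (H1 r Hr). specialize (H2 B Hlb).
  destruct (Glb_Rbar E); simpl in *; tauto.
Qed.

Lemma infR_greatest (E : R -> Prop) (B : R) :
  (exists r, E r) -> (forall s, E s -> B <= s) -> B <= infR E.
Proof.
  intros [r Hr] HB. unfold infR. destruct (Glb_Rbar_correct E) as [H1 H2].
  assert (Hlb : is_lb_Rbar E B) by (intros s Hs; apply HB, Hs).
  specialize (H1 r Hr). specialize (H2 B Hlb).
  destruct (Glb_Rbar E); simpl in *; tauto.
Qed.

Lemma inI_00 : inI 0 0.
Proof. split; lra. Qed.

Lemma normCB_nonneg (f : R -> R -> R) : 0 <= normCB f.
Proof. apply supR_nonneg. intros s (x & y & _ & ->). apply Rabs_pos. Qed.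

Lemma normCB_upper (f : R -> R -> R) (x y : R) :
  bounded_on_I f -> inI x y -> Rabs (f x y) <= normCB f.
Proof.
  intros [B HB] Hxy. apply supR_upper with B; [|eauto].
  intros s (u & v & Huv & ->). auto.
Qed.

Lemma normCB_least (f : R -> R -> R) (B : R) :
  (forall x y, inI x y -> Rabs (f x y) <= B) -> normCB f <= B.
Proof.
  intros H. apply supR_least.
  - exists (Rabs (f 0 0)), 0, 0. split; [apply inI_00|reflexivity].
  - intros s (x & y & Hxy & ->). auto.
Qed.

Lemma normCB2_nonneg (g : R -> R -> R) : 0 <= normCB2 g.
Proof.
  unfold normCB2.
  pose proof (normCB_nonneg g). pose proof (normCB_nonneg (partialI 1 0 g)).
  pose proof (normCB_nonneg (partialI 2 0 g)). pose proof (normCB_nonneg (partialI 0 1 g)).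
  pose proof (normCB_nonneg (partialI 0 2 g)). lra.
Qed.

Lemma omega_upper (f : R -> R -> R) (d u v x y : R) :
  bounded_on_I f -> inI u v -> inI x y -> sqrt ((u - x) ^ 2 + (v - y) ^ 2) <= d ->
  Rabs (f u v - f x y) <= omega f d.
Proof.
  intros [B HB] Huv Hxy Hd. apply supR_upper with (B + B).
  - intros s (u' & v' & x' & y' & H1 & H2 & _ & ->).
    pose proof (HB _ _ H1). pose proof (HB _ _ H2).
    unfold Rminus. eapply Rle_trans; [apply Rabs_triang|]. rewrite Rabs_Ropp. lra.
  - exists u, v, x, y. auto.
Qed.

Lemma omega2_nonneg (f : R -> R -> R) (d : R) : 0 <= omega2 f d.
Proof.
  apply supR_nonneg. intros s (x & y & h & k & _ & _ & _ & ->). apply Rabs_pos.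
Qed.

Lemma omega2_upper (f : R -> R -> R) (d x y h k : R) :
  bounded_on_I f -> inI x y -> inI (x + 2 * h) (y + 2 * k) ->
  0 < sqrt (h ^ 2 + k ^ 2) <= d ->
  Rabs (f (x + 2 * h) (y + 2 * k) - 2 * f (x + h) (y + k) + f x y) <= omega2 f d.
Proof.
  intros [B HB] Hxy Hxy2 Hd. apply supR_upper with (4 * B).
  - intros s (x' & y' & h' & k' & H1 & _ & H2 & ->).
    assert (H3 : inI (x' + h') (y' + k')) by (unfold inI in *; lra).
    pose proof (HB _ _ H1) as A1. pose proof (HB _ _ H2) as A2. pose proof (HB _ _ H3) as A3.
    apply Rabs_le_between in A1, A2, A3. apply Rabs_le. lra.
  - exists x, y, h, k. auto.
Qed.

(** * Bounded uniformly continuous functions on the plane *)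

(** Working on the plane makes ordinary continuity, derivatives and integrals
    available at the boundary of the quadrant.  The box-shaped neighbourhoods and
    the weak inequality are what passes through integration in one variable. *)
Definition BUC (F : R -> R -> R) : Prop :=
  (exists B, forall x y, Rabs (F x y) <= B) /\
  (forall eps, 0 < eps -> exists eta, 0 < eta /\ forall u v x y,
     Rabs (u - x) < eta -> Rabs (v - y) < eta -> Rabs (F u v - F x y) <= eps).

Lemma sqrt_sum_squares_le (p q : R) : sqrt (p ^ 2 + q ^ 2) <= Rabs p + Rabs q.
Proof.
  pose proof (Rabs_pos p). pose proof (Rabs_pos q).
  rewrite <- (sqrt_pow2 (Rabs p + Rabs q)) by lra.
  apply sqrt_le_1_alt. rewrite <- (pow2_abs p), <- (pow2_abs q). nra.
Qed.

Lemma Rabs_le_sqrt_sum_squares (p q : R) : Rabs p <= sqrt (p ^ 2 + q ^ 2).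
Proof.
  rewrite <- (sqrt_pow2 (Rabs p)) by apply Rabs_pos.
  apply sqrt_le_1_alt. rewrite pow2_abs. nra.
Qed.

(** Composition with the nearest-point retraction onto the quadrant, which is
    1-Lipschitz and so preserves uniform continuity. *)
Definition ext (f : R -> R -> R) (x y : R) : R := f (Rmax 0 x) (Rmax 0 y).

Lemma Rmax0_lip (u x : R) : Rabs (Rmax 0 u - Rmax 0 x) <= Rabs (u - x).
Proof.
  unfold Rmax. destruct (Rle_dec 0 u), (Rle_dec 0 x); split_Rabs; lra.
Qed.

Lemma inI_Rmax0 (x y : R) : inI (Rmax 0 x) (Rmax 0 y).
Proof. split; apply Rmax_l. Qed.

Lemma ext_inI (f : R -> R -> R) (x y : R) : inI x y -> ext f x y = f x y.
Proof. intros [Hx Hy]. unfold ext. now rewrite !Rmax_right. Qed.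

Lemma BUC_ext (f : R -> R -> R) : CB f -> BUC (ext f).
Proof.
  intros [[B HB] HU]. split.
  - exists B. intros x y. apply HB, inI_Rmax0.
  - intros eps He. destruct (HU eps He) as [eta [Heta H]].
    exists (eta / 2). split; [lra|]. intros u v x y Hu Hv.
    left. apply H; try apply inI_Rmax0.
    eapply Rle_lt_trans; [apply sqrt_sum_squares_le|].
    pose proof (Rmax0_lip u x). pose proof (Rmax0_lip v y). lra.
Qed.

Lemma CB_BUC (F : R -> R -> R) : BUC F -> CB F.
Proof.
  intros [[B HB] HU]. split.
  - exists B. intros; apply HB.
  - intros eps He. destruct (HU (eps / 2)) as [eta [Heta H]]; [lra|].
    exists eta. split; auto. intros u v x y _ _ Hd.
    apply Rle_lt_trans with (eps / 2); [|lra]. apply H.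
    + eapply Rle_lt_trans; [apply Rabs_le_sqrt_sum_squares|exact Hd].
    + rewrite Rplus_comm in Hd.
      eapply Rle_lt_trans; [apply Rabs_le_sqrt_sum_squares|exact Hd].
Qed.

Lemma BUC_swap (F : R -> R -> R) : BUC F -> BUC (fun x y => F y x).
Proof.
  intros [[B HB] HU]. split; [exists B; auto|].
  intros eps He. destruct (HU eps He) as [eta [Heta H]]. exists eta. split; auto.
Qed.

Lemma BUC_const (c : R) : BUC (fun _ _ => c).
Proof.
  split.
  - exists (Rabs c). intros; lra.
  - intros eps He. exists 1. split; [lra|]. intros. rewrite Rminus_diag_eq, Rabs_R0; lra.
Qed.

Lemma BUC_lincomb (al be : R) (F G : R -> R -> R) :
  BUC F -> BUC G -> BUC (fun x y => al * F x y + be * G x y).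
Proof.
  intros [[B HB] HF] [[C HC] HG]. split.
  - exists (Rabs al * B + Rabs be * C). intros x y.
    eapply Rle_trans; [apply Rabs_triang|]. rewrite !Rabs_mult.
    pose proof (Rabs_pos al). pose proof (Rabs_pos be).
    apply Rplus_le_compat; apply Rmult_le_compat_l; auto.
  - intros eps He. pose proof (Rabs_pos al) as Ha. pose proof (Rabs_pos be) as Hb.
    set (m := Rabs al + Rabs be + 1).
    assert (Hm : 0 < eps / m) by (apply Rdiv_lt_0_compat; unfold m; lra).
    destruct (HF _ Hm) as [e1 [He1 H1]]. destruct (HG _ Hm) as [e2 [He2 H2]].
    exists (Rmin e1 e2). split; [now apply Rmin_pos|].
    intros u v x y Hu Hv.
    assert (A1 : Rabs (F u v - F x y) <= eps / m).
    { apply H1; eapply Rlt_le_trans; eauto; apply Rmin_l. }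
    assert (A2 : Rabs (G u v - G x y) <= eps / m).
    { apply H2; eapply Rlt_le_trans; eauto; apply Rmin_r. }
    replace (_ - _) with (al * (F u v - F x y) + be * (G u v - G x y)) by ring.
    eapply Rle_trans; [apply Rabs_triang|]. rewrite !Rabs_mult.
    apply Rle_trans with ((Rabs al + Rabs be) * (eps / m)); [nra|].
    replace eps with (m * (eps / m)) at 2 by (field; unfold m; lra).
    apply Rmult_le_compat_r; unfold m in *; lra.
Qed.

Lemma BUC_translate (h : R) (F : R -> R -> R) : BUC F -> BUC (fun x y => F x (y + h)).
Proof.
  intros [[B HB] HU]. split; [exists B; auto|].
  intros eps He. destruct (HU eps He) as [eta [Heta H]]. exists eta. split; auto.
  intros u v x y Hu Hv. apply H; auto. now replace (v + h - (y + h)) with (v - y) by ring.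
Qed.

Lemma BUC_continuous (F : R -> R -> R) : BUC F -> forall x y, continuous (F x) y.
Proof.
  intros [_ HU] x y. apply continuity_pt_filterlim.
  intros eps He. destruct (HU (eps / 2)) as [eta [Heta H]]; [lra|].
  exists eta. split; auto. intros v [_ Hv]. simpl in *. unfold R_dist in *.
  apply Rle_lt_trans with (eps / 2); [|lra]. apply H; auto.
  rewrite Rminus_diag_eq, Rabs_R0; auto.
Qed.

Lemma BUC_continuous_l (F : R -> R -> R) :
  BUC F -> forall x y, continuous (fun u => F u y) x.
Proof. intros H x y. exact (BUC_continuous _ (BUC_swap _ H) y x). Qed.

Lemma ex_RInt_cont (f : R -> R) (a b : R) : (forall t, continuous f t) -> ex_RInt f a b.
Proof. intros H. apply (ex_RInt_continuous (V := R_CompleteNormedModule)). auto. Qed.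

Lemma BUC_RInt (F : R -> R -> R) (a b : R) :
  BUC F -> a <= b -> BUC (fun x y => RInt (fun s => F x (y + s)) a b).
Proof.
  intros HF Hab.
  assert (Hex : forall x y, ex_RInt (fun s => F x (y + s)) a b).
  { intros x y. apply ex_RInt_cont. intros t.
    apply (continuous_comp (fun s => y + s) (F x)).
    - apply (continuous_plus (fun _ => y) (fun s => s)); [apply continuous_const|apply continuous_id].
    - now apply BUC_continuous. }
  destruct HF as [[B HB] HU]. split.
  - exists ((b - a) * B). intros x y. apply abs_RInt_le_const; auto.
  - intros eps He.
    assert (Hm : 0 < eps / (b - a + 1)) by (apply Rdiv_lt_0_compat; lra).
    destruct (HU _ Hm) as [eta [Heta H]]. exists eta. split; auto.
    intros u v x y Hu Hv.
    rewrite <- (RInt_minus (V := R_CompleteNormedModule)); auto.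
    apply Rle_trans with ((b - a) * (eps / (b - a + 1))).
    + apply abs_RInt_le_const; auto.
      * apply (ex_RInt_minus (V := R_NormedModule)); auto.
      * intros t _. apply H; auto. now replace (v + t - (y + t)) with (v - y) by ring.
    + replace eps with ((b - a + 1) * (eps / (b - a + 1))) at 2 by (field; lra).
      apply Rmult_le_compat_r; lra.
Qed.

(** * Derivatives relative to the half-line *)

(** Every point of the half-line is a limit of other points of it, on the right. *)
Lemma is_deriv_nonneg_unique (f : R -> R) (x l l' : R) :
  0 <= x -> is_deriv_nonneg f x l -> is_deriv_nonneg f x l' -> l = l'.
Proof.
  intros Hx H H'. eapply single_limit; [|exact H|exact H'].
  intros alp Ha. exists (x + alp / 2). split; [split; lra|].
  unfold Rdist. replace (x + alp / 2 - x) with (alp / 2) by ring.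
  rewrite Rabs_pos_eq; lra.
Qed.

Lemma deriv_nonneg_eq (f : R -> R) (x l : R) :
  0 <= x -> is_deriv_nonneg f x l -> deriv_nonneg f x = l.
Proof.
  intros Hx H.
  apply (iota_unique (V := R_CompleteNormedModule) (fun l => is_deriv_nonneg f x l)); auto.
  intros y Hy. now apply (is_deriv_nonneg_unique f x).
Qed.

Lemma deriv_nonneg_correct (f : R -> R) (x : R) :
  0 <= x -> ex_deriv_nonneg f x -> is_deriv_nonneg f x (deriv_nonneg f x).
Proof. intros Hx [l Hl]. now rewrite (deriv_nonneg_eq f x l). Qed.

Lemma is_deriv_nonneg_ext (f g : R -> R) (x l : R) :
  (forall t, 0 <= t -> f t = g t) -> 0 <= x ->
  is_deriv_nonneg f x l -> is_deriv_nonneg g x l.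
Proof.
  intros E Hx H eps He. destruct (H eps He) as [alp [Ha H1]].
  exists alp. split; auto. intros t Ht. rewrite <- !E; auto. apply Ht.
Qed.

Lemma is_derive_is_deriv_nonneg (f : R -> R) (x l : R) :
  is_derive f x l -> is_deriv_nonneg f x l.
Proof.
  intros H. apply is_derive_Reals in H. intros eps He.
  destruct (H eps He) as [alp Ha]. exists alp. split; [apply cond_pos|].
  intros t [[_ Ht] Hd]. simpl in *. unfold Rdist in *.
  specialize (Ha (t - x)). replace (x + (t - x)) with t in Ha by ring.
  apply Ha; auto. lra.
Qed.

(** Composing with [Rmax 0] makes the function continuous on the whole line and
    does not change it near interior points, so the usual theorem applies. *)
Lemma deriv_nonneg_MVT (phi phi1 : R -> R) (a b : R) :
  (forall t, 0 <= t -> is_deriv_nonneg phi t (phi1 t)) -> 0 <= a -> 0 <= b ->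
  exists c, Rmin a b <= c <= Rmax a b /\ phi b - phi a = phi1 c * (b - a).
Proof.
  intros H Ha Hb.
  assert (H0 : 0 <= Rmin a b) by now apply Rmin_glb.
  destruct (MVT_gen (fun t => phi (Rmax 0 t)) a b phi1) as [c [Hc E]].
  - intros t Ht. apply is_derive_Reals. intros eps He.
    destruct (H t ltac:(lra) eps He) as [alp [Halp H1]].
    assert (Hp : 0 < Rmin alp t) by (apply Rmin_pos; lra).
    exists (mkposreal _ Hp). simpl. intros k Hk Hkt.
    pose proof (Rmin_l alp t). pose proof (Rmin_r alp t).
    assert (0 <= t + k) by (apply Rabs_def2 in Hkt; lra).
    rewrite !Rmax_right by lra.
    specialize (H1 (t + k)). simpl in H1. unfold Rdist in H1.
    replace (t + k - t) with k in H1 by ring. apply H1.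
    repeat split; auto; lra.
  - intros t Ht eps He.
    destruct (cont_deriv _ _ _ _ (H t ltac:(lra)) eps He) as [alp [Halp H1]].
    exists alp. split; auto. intros s [_ Hs]. simpl in *. unfold Rdist in *.
    rewrite (Rmax_right 0 t) by lra.
    destruct (Req_dec (Rmax 0 s) t) as [Es|Es].
    + rewrite Es, Rminus_diag_eq, Rabs_R0; auto.
    + apply H1. split; [split; [apply Rmax_l|auto]|].
      eapply Rle_lt_trans; [|exact Hs].
      rewrite <- (Rmax_right 0 t) at 1 by lra. apply Rmax0_lip.
  - exists c. split; auto. now rewrite !Rmax_right in E.
Qed.

(** Two applications of the mean value theorem; the missing factor 1/2 is
    harmless, as the K-functional enters the final bound with the factor 4. *)
Lemma deriv_nonneg_taylor (phi phi1 phi2 : R -> R) (C m u : R) :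
  (forall t, 0 <= t -> is_deriv_nonneg phi t (phi1 t)) ->
  (forall t, 0 <= t -> is_deriv_nonneg phi1 t (phi2 t)) ->
  (forall t, 0 <= t -> Rabs (phi2 t) <= C) -> 0 <= m -> 0 <= u ->
  Rabs (phi u - phi m - phi1 m * (u - m)) <= C * (u - m) ^ 2.
Proof.
  intros H1 H2 HC Hm Hu.
  destruct (deriv_nonneg_MVT phi phi1 m u H1 Hm Hu) as [c [Hc E]].
  assert (Hc0 : 0 <= c) by (pose proof (Rmin_glb m u 0 Hm Hu); lra).
  destruct (deriv_nonneg_MVT phi1 phi2 m c H2 Hm Hc0) as [e [He E']].
  assert (He0 : 0 <= e) by (pose proof (Rmin_glb m c 0 Hm Hc0); lra).
  rewrite E. replace (_ - _) with ((phi1 c - phi1 m) * (u - m)) by ring.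
  rewrite E', !Rabs_mult, <- pow2_abs.
  assert (Hd : Rabs (c - m) <= Rabs (u - m)).
  { unfold Rmin, Rmax in Hc. destruct (Rle_dec m u); split_Rabs; lra. }
  pose proof (HC e He0). pose proof (Rabs_pos (u - m)). pose proof (Rabs_pos (c - m)).
  pose proof (Rabs_pos (phi2 e)).
  replace (C * Rabs (u - m) ^ 2) with (C * Rabs (u - m) * Rabs (u - m)) by ring.
  apply Rmult_le_compat_r; auto. apply Rmult_le_compat; auto.
Qed.

(** Taylor's formula with step 1 expresses the first derivative through two
    values of the function and the second derivative. *)
Lemma deriv_nonneg_landau (phi phi1 phi2 : R -> R) (A C x : R) :
  (forall t, 0 <= t -> is_deriv_nonneg phi t (phi1 t)) ->
  (forall t, 0 <= t -> is_deriv_nonneg phi1 t (phi2 t)) ->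
  (forall t, 0 <= t -> Rabs (phi t) <= A) ->
  (forall t, 0 <= t -> Rabs (phi2 t) <= C) -> 0 <= x ->
  Rabs (phi1 x) <= 2 * A + C.
Proof.
  intros H1 H2 HA HC Hx.
  pose proof (deriv_nonneg_taylor phi phi1 phi2 C x (x + 1) H1 H2 HC Hx ltac:(lra)) as T.
  replace (x + 1 - x) with 1 in T by ring.
  pose proof (HA x Hx) as A1. pose proof (HA (x + 1) ltac:(lra)) as A2.
  apply Rabs_le_between in T, A1, A2. apply Rabs_le. lra.
Qed.

Lemma CB_ext (f g : R -> R -> R) :
  (forall x y, inI x y -> f x y = g x y) -> CB f -> CB g.
Proof.
  intros E [[B HB] HU]. split.
  - exists B. intros x y Hxy. rewrite <- E; auto.
  - intros eps He. destruct (HU eps He) as [eta [Heta H]]. exists eta. split; auto.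
    intros u v x y Hu Hv Hd. rewrite <- !E; auto.
Qed.

Section CB2_family.
Variable G : nat -> nat -> R -> R -> R.
Hypothesis G_BUC : forall p q, BUC (G p q).
Hypothesis G_dy : forall q x y, (q < 2)%nat ->
  is_derive (fun v => G 0 q x v) y (G 0 (S q) x y).
Hypothesis G_dx : forall p q x y, (p < 2)%nat -> (q <= 2)%nat ->
  is_derive (fun u => G p q u y) x (G (S p) q x y).

(** Identifies the partial derivatives defined by unique choice when explicit
    candidates [G p q] are at hand.  Derivatives in the second variable are taken
    first, so they are only needed along [p = 0]. *)
Lemma partialI_family (p q : nat) (x y : R) :
  (p <= 2)%nat -> (q <= 2)%nat -> inI x y -> partialI p q (G 0 0) x y = G p q x y.
Proof.
  intros Hp Hq [Hx Hy]. unfold partialI.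
  assert (E : forall u, deriv_nonneg_n q (fun v => G 0 0 u v) y = G 0 q u y).
  { intros u. revert y Hy. induction q as [|q IH]; intros y Hy; [reflexivity|].
    simpl. apply deriv_nonneg_eq; auto.
    apply (is_deriv_nonneg_ext (fun v => G 0 q u v)); auto.
    - intros t Ht. rewrite IH; auto. lia.
    - apply is_derive_is_deriv_nonneg, G_dy. lia. }
  revert x Hx. induction p as [|p IH]; intros x Hx; simpl; [apply E|].
  apply deriv_nonneg_eq; auto.
  apply (is_deriv_nonneg_ext (fun u => G p q u y)); auto.
  - intros t Ht. rewrite IH; auto. lia.
  - apply is_derive_is_deriv_nonneg, G_dx; lia.
Qed.

Lemma CB2_family : CB2 (G 0 0).
Proof.
  split; [|split].
  - intros q x y Hq [Hx Hy]. exists (G 0 (S q) x y).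
    apply (is_deriv_nonneg_ext (fun v => G 0 q x v)); auto.
    + intros t Ht. rewrite partialI_family; auto; try lia. now split.
    + now apply is_derive_is_deriv_nonneg, G_dy.
  - intros p q x y Hp Hq [Hx Hy]. exists (G (S p) q x y).
    apply (is_deriv_nonneg_ext (fun u => G p q u y)); auto.
    + intros t Ht. rewrite partialI_family; auto; try lia. now split.
    + now apply is_derive_is_deriv_nonneg, G_dx.
  - intros p q Hp Hq. apply CB_ext with (G p q).
    + intros x y Hxy. now rewrite partialI_family.
    + now apply CB_BUC.
Qed.
End CB2_family.

Section CB2_facts.
Variable g : R -> R -> R.
Hypothesis Hg : CB2 g.

Lemma CB2_CB (p q : nat) : (p <= 2)%nat -> (q <= 2)%nat -> CB (partialI p q g).
Proof. apply Hg. Qed.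

Lemma CB2_dx (p : nat) (x y : R) :
  (p < 2)%nat -> inI x y ->
  is_deriv_nonneg (fun u => partialI p 0 g u y) x (partialI (S p) 0 g x y).
Proof.
  intros Hp Hxy. apply (deriv_nonneg_correct (fun u => partialI p 0 g u y)); [apply Hxy|].
  apply Hg; auto.
Qed.

Lemma CB2_dy (q : nat) (x y : R) :
  (q < 2)%nat -> inI x y ->
  is_deriv_nonneg (fun v => partialI 0 q g x v) y (partialI 0 (S q) g x y).
Proof.
  intros Hq Hxy. apply (deriv_nonneg_correct (fun v => partialI 0 q g x v)); [apply Hxy|].
  apply Hg; auto.
Qed.

Lemma CB2_upper (p q : nat) (x y : R) :
  (p <= 2)%nat -> (q <= 2)%nat -> inI x y ->
  Rabs (partialI p q g x y) <= normCB (partialI p q g).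
Proof. intros Hp Hq. apply normCB_upper. now apply CB2_CB. Qed.

(** The first-order terms of the norm are absorbed by the others, separately on
    horizontal and vertical half-lines. *)
Lemma normCB2_le :
  normCB2 g <= 5 * normCB g + 2 * normCB (partialI 2 0 g) + 2 * normCB (partialI 0 2 g).
Proof.
  assert (Hx : normCB (partialI 1 0 g) <= 2 * normCB g + normCB (partialI 2 0 g)).
  { apply normCB_least. intros x y [Hx Hy].
    apply (deriv_nonneg_landau (fun u => partialI 0 0 g u y) (fun u => partialI 1 0 g u y)
      (fun u => partialI 2 0 g u y)); auto; intros t Ht.
    - now apply CB2_dx; [lia|split].
    - now apply CB2_dx; [lia|split].
    - now apply (CB2_upper 0 0); [lia|lia|split].
    - now apply CB2_upper; [lia|lia|split]. }
  assert (Hy : normCB (partialI 0 1 g) <= 2 * normCB g + normCB (partialI 0 2 g)).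
  { apply normCB_least. intros x y [H0 H1].
    apply (deriv_nonneg_landau (fun u => partialI 0 0 g x u) (fun u => partialI 0 1 g x u)
      (fun u => partialI 0 2 g x u)); auto; intros t Ht.
    - now apply CB2_dy; [lia|split].
    - now apply CB2_dy; [lia|split].
    - now apply (CB2_upper 0 0); [lia|lia|split].
    - now apply CB2_upper; [lia|lia|split]. }
  unfold normCB2. lra.
Qed.
End CB2_facts.

Lemma Kfunctional_le (f g : R -> R -> R) (d : R) :
  0 <= d -> CB2 g -> Kfunctional f d <= normCB (fun x y => f x y - g x y) + d * normCB2 g.
Proof.
  intros Hd Hg. apply infR_lower with 0; [|eauto].
  intros s (g' & _ & ->).
  pose proof (normCB_nonneg (fun x y => f x y - g' x y)).
  pose proof (Rmult_le_pos _ _ Hd (normCB2_nonneg g')). lra.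
Qed.

Lemma CB2_0 : CB2 (fun _ _ => 0).
Proof.
  apply (CB2_family (fun _ _ _ _ => 0)); intros.
  - apply BUC_const.
  - apply (is_derive_const (K := R_AbsRing) (V := R_NormedModule)).
  - apply (is_derive_const (K := R_AbsRing) (V := R_NormedModule)).
Qed.

Lemma normCB2_0 : normCB2 (fun _ _ => 0) <= 0.
Proof.
  pose (G := fun (_ _ : nat) (_ _ : R) => 0).
  assert (E : forall p q, (p <= 2)%nat -> (q <= 2)%nat ->
    normCB (partialI p q (G 0%nat 0%nat)) <= 0).
  { intros p q Hp Hq. apply normCB_least. intros x y Hxy.
    rewrite (partialI_family G); auto.
    - unfold G. rewrite Rabs_R0. lra.
    - intros. unfold G. apply (is_derive_const (K := R_AbsRing) (V := R_NormedModule)).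
    - intros. unfold G. apply (is_derive_const (K := R_AbsRing) (V := R_NormedModule)). }
  pose proof (E 0 0)%nat. pose proof (E 1 0)%nat. pose proof (E 2 0)%nat.
  pose proof (E 0 1)%nat. pose proof (E 0 2)%nat.
  unfold normCB2. change (fun _ _ => 0) with (G 0%nat 0%nat).
  change (partialI 0 0 (G 0%nat 0%nat)) with (G 0%nat 0%nat) in *.
  repeat match goal with H : (_ <= _)%nat -> _ |- _ => specialize (H ltac:(lia) ltac:(lia)) end.
  lra.
Qed.

Lemma Kfunctional_le_norm (f : R -> R -> R) (d : R) :
  CB f -> 0 <= d -> Kfunctional f d <= normCB f.
Proof.
  intros Hf Hd. eapply Rle_trans; [apply (Kfunctional_le f (fun _ _ => 0)); auto; apply CB2_0|].
  assert (normCB (fun x y => f x y - 0) <= normCB f).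
  { apply normCB_least. intros x y Hxy. rewrite Rminus_0_r. apply normCB_upper; auto. apply Hf. }
  pose proof normCB2_0. nra.
Qed.

(** * Steklov means in one variable *)

Definition avg (h : R) (phi : R -> R) (x : R) : R := RInt (fun s => phi (x + h * s)) 0 1.
Definition dq (h : R) (phi : R -> R) (x : R) : R := (phi (x + h) - phi x) / h.

(** For [p <= 2], the [p]-th derivative of [avg h (avg h phi)]: each
    differentiation turns one average into a difference quotient. *)
Definition iter_avg (p : nat) (h : R) (phi : R -> R) : R -> R :=
  match p with
  | O => avg h (avg h phi)
  | S O => dq h (avg h phi)
  | _ => dq h (dq h phi)
  end.

(** For [p <= 2], the [p]-th derivative of the Steklov mean [2 A_h^2 - A_(2h)^2]. *)
Definition steklov (p : nat) (h : R) (phi : R -> R) (x : R) : R :=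
  2 * iter_avg p h phi x - iter_avg p (2 * h) phi x.

Lemma continuous_affine (phi : R -> R) (x h : R) :
  (forall t, continuous phi t) -> forall s, continuous (fun s => phi (x + h * s)) s.
Proof.
  intros H s. apply (continuous_comp (fun s => x + h * s) phi); [|apply H].
  apply (continuous_plus (fun _ => x) (fun s => h * s)); [apply continuous_const|].
  apply (continuous_mult (fun _ => h) (fun s => s)); [apply continuous_const|apply continuous_id].
Qed.

Lemma ex_RInt_avg (phi : R -> R) (x h : R) :
  (forall t, continuous phi t) -> ex_RInt (fun s => phi (x + h * s)) 0 1.
Proof. intros H. apply ex_RInt_cont. now apply continuous_affine. Qed.

(** Substitution [u = x + h s]; this form can be differentiated in [x]. *)
Lemma avg_primitive (phi : R -> R) (h x : R) :
  (forall t, continuous phi t) -> h <> 0 ->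
  avg h phi x = / h * (RInt phi 0 (x + h) - RInt phi 0 x).
Proof.
  intros H Hh.
  assert (Hex : forall a b, ex_RInt phi a b) by (intros; now apply ex_RInt_cont).
  assert (E : RInt (fun s => scal h (phi (h * s + x))) 0 1 = RInt phi (h * 0 + x) (h * 1 + x)).
  { apply (RInt_comp_lin (V := R_CompleteNormedModule)). apply Hex. }
  rewrite (RInt_scal (V := R_CompleteNormedModule)) in E.
  2: { apply ex_RInt_ext with (fun s => phi (x + h * s)); [|now apply ex_RInt_avg].
       intros s _. f_equal. ring. }
  replace (h * 0 + x) with x in E by ring. replace (h * 1 + x) with (x + h) in E by ring.
  pose proof (RInt_Chasles (V := R_CompleteNormedModule) phi 0 x (x + h) (Hex _ _) (Hex _ _)) as C.
  change (RInt phi 0 x + RInt phi x (x + h) = RInt phi 0 (x + h)) in C.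
  replace (RInt phi 0 (x + h) - RInt phi 0 x) with (RInt phi x (x + h)) by lra.
  rewrite <- E. unfold avg.
  change (scal h (RInt (fun s => phi (h * s + x)) 0 1))
    with (h * (RInt (fun s => phi (h * s + x)) 0 1)).
  rewrite <- Rmult_assoc, Rinv_l, Rmult_1_l by assumption.
  apply (RInt_ext (V := R_CompleteNormedModule)). intros s _. f_equal. ring.
Qed.

Lemma is_derive_avg (phi : R -> R) (h x : R) :
  (forall t, continuous phi t) -> h <> 0 -> is_derive (avg h phi) x (dq h phi x).
Proof.
  intros H Hh.
  apply (is_derive_ext (fun x => / h * (RInt phi 0 (x + h) - RInt phi 0 x))).
  { intros t. symmetry. now apply avg_primitive. }
  assert (HD : forall z, is_derive (RInt phi 0) z (phi z)).
  { intros z. apply (is_derive_RInt phi (RInt phi 0) 0 z); [|apply H].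
    apply filter_forall. intros w. apply (RInt_correct (V := R_CompleteNormedModule)). now apply ex_RInt_cont. }
  replace (dq h phi x) with (/ h * (1 * phi (x + h) - phi x)) by (unfold dq; field; auto).
  apply is_derive_scal, (is_derive_minus (fun z => RInt phi 0 (z + h)) (RInt phi 0)); [|apply HD].
  apply (is_derive_comp (RInt phi 0) (fun z => z + h)); [apply HD|].
  auto_derive; auto.
Qed.

Lemma continuous_avg (phi : R -> R) (h : R) :
  (forall t, continuous phi t) -> h <> 0 -> forall t, continuous (avg h phi) t.
Proof.
  intros H Hh t. apply (ex_derive_continuous (V := R_NormedModule)). exists (dq h phi t). now apply is_derive_avg.
Qed.

Lemma is_derive_dq (phi phi' : R -> R) (h x : R) :
  (forall t, is_derive phi t (phi' t)) -> is_derive (dq h phi) x (dq h phi' x).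
Proof.
  intros H. unfold dq, Rdiv.
  apply (is_derive_ext (fun x => / h * (phi (x + h) - phi x))); [intros; apply Rmult_comm|].
  rewrite Rmult_comm.
  replace (phi' (x + h) - phi' x) with (1 * phi' (x + h) - phi' x) by ring.
  apply is_derive_scal, (is_derive_minus (fun z => phi (z + h)) phi); [|apply H].
  apply (is_derive_comp phi (fun z => z + h)); [apply H|]. auto_derive; auto.
Qed.

Lemma is_derive_iter_avg (p : nat) (phi : R -> R) (h x : R) :
  (p < 2)%nat -> (forall t, continuous phi t) -> h <> 0 ->
  is_derive (iter_avg p h phi) x (iter_avg (S p) h phi x).
Proof.
  intros Hp H Hh. destruct p as [|[|p]]; [| |lia]; simpl.
  - apply is_derive_avg; auto. now apply continuous_avg.
  - apply is_derive_dq. intros t. now apply is_derive_avg.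
Qed.

Lemma is_derive_steklov (p : nat) (phi : R -> R) (h x : R) :
  (p < 2)%nat -> (forall t, continuous phi t) -> 0 < h ->
  is_derive (steklov p h phi) x (steklov (S p) h phi x).
Proof.
  intros Hp H Hh. unfold steklov.
  apply (is_derive_minus (fun x => 2 * iter_avg p h phi x) (iter_avg p (2 * h) phi)).
  - apply is_derive_scal, is_derive_iter_avg; auto; lra.
  - apply is_derive_iter_avg; auto; lra.
Qed.

Lemma avg_bound (phi : R -> R) (h B : R) :
  (forall t, continuous phi t) -> 0 < h -> (forall t, 0 <= t -> Rabs (phi t) <= B) ->
  forall x, 0 <= x -> Rabs (avg h phi x) <= B.
Proof.
  intros H Hh HB x Hx. replace B with ((1 - 0) * B) by ring.
  apply abs_RInt_le_const; [lra|now apply ex_RInt_avg|].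
  intros t Ht. apply HB. nra.
Qed.

Lemma steklov0_bound (phi : R -> R) (h B : R) :
  (forall t, continuous phi t) -> 0 < h -> (forall t, 0 <= t -> Rabs (phi t) <= B) ->
  forall x, 0 <= x -> Rabs (steklov 0 h phi x) <= 3 * B.
Proof.
  intros H Hh HB x Hx.
  assert (A : forall k, 0 < k -> Rabs (avg k (avg k phi) x) <= B).
  { intros k Hk. apply avg_bound; auto.
    - apply continuous_avg; auto; lra.
    - now apply avg_bound. }
  pose proof (A h Hh) as A1. pose proof (A (2 * h) ltac:(lra)) as A2.
  unfold steklov; simpl. apply Rabs_le_between in A1, A2. apply Rabs_le. lra.
Qed.

Definition diff2 (s : R) (phi : R -> R) (x : R) : R :=
  phi (x + 2 * s) - 2 * phi (x + s) + phi x.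

Lemma RInt_diff2 (f g : R -> R) (c : R) :
  (forall t, continuous f t) -> (forall t, continuous g t) ->
  RInt f 0 1 - 2 * RInt g 0 1 + c = RInt (fun s => f s - 2 * g s + c) 0 1.
Proof.
  intros Hf Hg. symmetry. apply is_RInt_unique.
  assert (I1 := RInt_correct (V := R_CompleteNormedModule) f 0 1 (ex_RInt_cont _ _ _ Hf)).
  assert (I2 := RInt_correct (V := R_CompleteNormedModule) g 0 1 (ex_RInt_cont _ _ _ Hg)).
  assert (I3 := is_RInt_const (V := R_CompleteNormedModule) 0 1 c).
  assert (I4 := is_RInt_plus (V := R_NormedModule) _ _ _ _ _ _
     (is_RInt_minus (V := R_NormedModule) _ _ _ _ _ _ I1 (is_RInt_scal (V := R_NormedModule) _ _ _ 2 _ I2)) I3).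
  refine (eq_ind _ (is_RInt _ 0 1) I4 _ _).
  change (RInt f 0 1 + - (2 * RInt g 0 1) + (1 - 0) * c = RInt f 0 1 - 2 * RInt g 0 1 + c). ring.
Qed.

(** Writing out the averages, [phi x - steklov 0 h phi x] is the mean over
    [s, t] in the unit square of the second difference of [phi] at [x] with step
    [h (s + t)], which is at most [2 h]. *)
Lemma steklov0_error (phi : R -> R) (h w : R) :
  (forall t, continuous phi t) -> 0 < h ->
  (forall s t, 0 <= s <= 2 * h -> 0 <= t -> Rabs (diff2 s phi t) <= w) ->
  forall x, 0 <= x -> Rabs (steklov 0 h phi x - phi x) <= w.
Proof.
  intros H Hh Hw x Hx.
  assert (Ha : forall k, 0 < k -> forall t, continuous (avg k phi) t)
    by (intros; apply continuous_avg; auto; lra).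
  assert (E : phi x - steklov 0 h phi x =
    RInt (fun s => RInt (fun t => diff2 (h * s + h * t) phi x) 0 1) 0 1).
  { unfold steklov. simpl iter_avg.
    replace (phi x - _) with (avg (2 * h) (avg (2 * h) phi) x - 2 * avg h (avg h phi) x + phi x) by ring.
    unfold avg at 1 3.
    rewrite RInt_diff2 by (apply continuous_affine; apply Ha; lra).
    apply (RInt_ext (V := R_CompleteNormedModule)). intros s _. unfold avg.
    rewrite RInt_diff2 by (now apply continuous_affine).
    apply (RInt_ext (V := R_CompleteNormedModule)). intros t _. unfold diff2.

      replace (x + 2 * h * s + 2 * h * t) with (x + 2 * (h * s + h * t)) by ring.
      now rewrite <- Rplus_assoc. }
  assert (Hc : forall k, continuous (fun s => RInt (fun t => diff2 (h * s + h * t) phi x) 0 1) k).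
  { intros k. apply (continuous_ext (fun s => avg (2 * h) phi (x + (2 * h) * s)
       - 2 * avg h phi (x + h * s) + phi x)).
    - intros s. unfold avg. rewrite RInt_diff2 by (now apply continuous_affine).
      apply (RInt_ext (V := R_CompleteNormedModule)). intros t _. unfold diff2.

      replace (x + 2 * h * s + 2 * h * t) with (x + 2 * (h * s + h * t)) by ring.
      now rewrite <- Rplus_assoc.
    - apply (continuous_plus (fun s => avg (2 * h) phi (x + 2 * h * s) - 2 * avg h phi (x + h * s))
        (fun _ => phi x)); [|apply continuous_const].
      apply (continuous_minus (fun s => avg (2 * h) phi (x + 2 * h * s))
        (fun s => 2 * avg h phi (x + h * s))).
      + apply (continuous_affine (avg (2 * h) phi)). apply Ha; lra.
      + apply (continuous_scal_r 2 (fun s => avg h phi (x + h * s))).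
        apply (continuous_affine (avg h phi)). apply Ha; lra. }
  rewrite Rabs_minus_sym, E. replace w with ((1 - 0) * w) by ring.
  apply abs_RInt_le_const; [lra|now apply ex_RInt_cont|].
  intros s Hs. replace w with ((1 - 0) * w) by ring.
  apply abs_RInt_le_const; [lra| |].
  - apply ex_RInt_cont. intros t. unfold diff2.
    apply (continuous_plus (fun t => phi (x + 2 * (h * s + h * t)) - 2 * phi (x + (h * s + h * t)))
        (fun _ => phi x)); [|apply continuous_const].
    apply (continuous_minus (fun t => phi (x + 2 * (h * s + h * t)))
        (fun t => 2 * phi (x + (h * s + h * t)))).
    + apply (continuous_ext (fun t => phi ((x + 2 * (h * s)) + (2 * h) * t))).
      * intros; f_equal; ring.
      * now apply continuous_affine.
    + apply (continuous_scal_r 2 (fun t => phi (x + (h * s + h * t)))).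
      apply (continuous_ext (fun t => phi ((x + (h * s)) + h * t))).
      * intros; f_equal; ring.
      * now apply continuous_affine.
  - intros t Ht. apply Hw; [nra|lra].
Qed.

Lemma dq_dq (phi : R -> R) (h x : R) : 0 < h -> dq h (dq h phi) x = diff2 h phi x / h ^ 2.
Proof.
  intros Hh. unfold dq, diff2. replace (x + h + h) with (x + 2 * h) by ring. field. lra.
Qed.

(** The second derivative is itself a combination of second differences, with
    steps [h] and [2 h]: [(2 h) ^ 2] times it is [8 diff2 h - diff2 (2 h)]. *)
Lemma steklov2_bound (phi : R -> R) (h w : R) :
  0 < h ->
  (forall s t, 0 <= s <= 2 * h -> 0 <= t -> Rabs (diff2 s phi t) <= w) ->
  forall x, 0 <= x -> (2 * h) ^ 2 * Rabs (steklov 2 h phi x) <= 9 * w.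
Proof.
  intros Hh Hw x Hx. unfold steklov. simpl iter_avg. rewrite !dq_dq by lra.
  pose proof (Hw h x ltac:(lra) Hx) as A1. pose proof (Hw (2 * h) x ltac:(lra) Hx) as A2.
  rewrite <- (Rabs_pos_eq ((2 * h) ^ 2)) at 1 by nra. rewrite <- Rabs_mult.
  replace ((2 * h) ^ 2 * _) with (8 * diff2 h phi x - diff2 (2 * h) phi x) by (field; lra).
  apply Rabs_le_between in A1, A2. apply Rabs_le. lra.
Qed.

Lemma avg_diff2 (f g k : R -> R) (h x : R) :
  (forall t, continuous f t) -> (forall t, continuous g t) -> (forall t, continuous k t) ->
  avg h f x - 2 * avg h g x + avg h k x = avg h (fun t => f t - 2 * g t + k t) x.
Proof.
  intros Hf Hg Hk. unfold avg. symmetry. apply is_RInt_unique.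
  assert (I1 := RInt_correct (V := R_CompleteNormedModule) _ 0 1 (ex_RInt_avg f x h Hf)).
  assert (I2 := RInt_correct (V := R_CompleteNormedModule) _ 0 1 (ex_RInt_avg g x h Hg)).
  assert (I3 := RInt_correct (V := R_CompleteNormedModule) _ 0 1 (ex_RInt_avg k x h Hk)).
  exact (is_RInt_plus (V := R_NormedModule) _ _ _ _ _ _
     (is_RInt_minus (V := R_NormedModule) _ _ _ _ _ _ I1 (is_RInt_scal (V := R_NormedModule) _ _ _ 2 _ I2)) I3).
Qed.

Lemma steklov0_diff2 (f g k : R -> R) (h x : R) :
  (forall t, continuous f t) -> (forall t, continuous g t) -> (forall t, continuous k t) ->
  0 < h ->
  steklov 0 h f x - 2 * steklov 0 h g x + steklov 0 h k x
  = steklov 0 h (fun t => f t - 2 * g t + k t) x.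
Proof.
  intros Hf Hg Hk Hh.
  assert (A : forall l, 0 < l -> avg l (avg l f) x - 2 * avg l (avg l g) x + avg l (avg l k) x
    = avg l (avg l (fun t => f t - 2 * g t + k t)) x).
  { intros l Hl. rewrite avg_diff2 by (apply continuous_avg; auto; lra).
    apply (RInt_ext (V := R_CompleteNormedModule)). intros s _. now apply avg_diff2. }
  unfold steklov; simpl iter_avg. rewrite <- !A by lra. ring.
Qed.

(** * Steklov means on the quadrant and the K-functional *)

(** Rescaling the second variable by [h] reduces this to [BUC_RInt]. *)
Lemma BUC_avg (h : R) (F : R -> R -> R) : 0 < h -> BUC F -> BUC (fun x y => avg h (F x) y).
Proof.
  intros Hh HF.
  destruct (BUC_RInt (fun x s => F x (h * s)) 0 1) as [HB HU].
  - destruct HF as [[B HB] HU]. split; [exists B; auto|].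
    intros eps He. destruct (HU eps He) as [eta [Heta H]].
    exists (Rmin eta (eta / h)). split.
    { apply Rmin_pos; auto. now apply Rdiv_lt_0_compat. }
    intros u v x y Hu Hv. apply H.
    + eapply Rlt_le_trans; [exact Hu|apply Rmin_l].
    + rewrite <- Rmult_minus_distr_l, Rabs_mult, (Rabs_pos_eq h) by lra.
      replace eta with (h * (eta / h)) by (field; lra).
      apply Rmult_lt_compat_l; auto. eapply Rlt_le_trans; [exact Hv|apply Rmin_r].
  - lra.
  - assert (E : forall x y, RInt (fun s => F x (h * (y / h + s))) 0 1 = avg h (F x) y).
    { intros x y. apply (RInt_ext (V := R_CompleteNormedModule)). intros s _. f_equal. field. lra. }
    split.
    + destruct HB as [B HB]. exists B. intros x y. rewrite <- E. apply HB.
    + intros eps He. destruct (HU eps He) as [eta [Heta H]].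
      exists (Rmin eta (h * eta)). split.
      { apply Rmin_pos; auto. now apply Rmult_lt_0_compat. }
      intros u v x y Hu Hv. rewrite <- !E. apply H.
      * eapply Rlt_le_trans; [exact Hu|apply Rmin_l].
      * replace (v / h - y / h) with (/ h * (v - y)) by (field; lra).
        rewrite Rabs_mult, Rabs_pos_eq by (left; now apply Rinv_0_lt_compat).
        apply (Rmult_lt_reg_l h); auto. rewrite <- Rmult_assoc, Rinv_r, Rmult_1_l by lra.
        eapply Rlt_le_trans; [exact Hv|apply Rmin_r].
Qed.

Lemma BUC_eq (F G : R -> R -> R) : (forall x y, F x y = G x y) -> BUC F -> BUC G.
Proof.
  intros E [[B HB] HU]. split.
  - exists B. intros. now rewrite <- E.
  - intros eps He. destruct (HU eps He) as [eta [Heta H]]. exists eta. split; auto.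
    intros. rewrite <- !E. auto.
Qed.

Lemma BUC_dq (h : R) (F : R -> R -> R) : BUC F -> BUC (fun x y => dq h (F x) y).
Proof.
  intros HF. apply (BUC_eq (fun x y => / h * F x (y + h) + (- / h) * F x y)).
  - intros. unfold dq, Rdiv. ring.
  - apply BUC_lincomb; auto. now apply BUC_translate.
Qed.

Lemma BUC_iter_avg (p : nat) (h : R) (F : R -> R -> R) :
  0 < h -> BUC F -> BUC (fun x y => iter_avg p h (F x) y).
Proof.
  intros Hh HF. destruct p as [|[|p]]; simpl.
  - apply (BUC_avg h (fun x y => avg h (F x) y)); auto. now apply BUC_avg.
  - apply (BUC_dq h (fun x y => avg h (F x) y)); auto. now apply BUC_avg.
  - apply (BUC_dq h (fun x y => dq h (F x) y)); auto. now apply BUC_dq.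
Qed.

Lemma BUC_steklov (p : nat) (h : R) (F : R -> R -> R) :
  0 < h -> BUC F -> BUC (fun x y => steklov p h (F x) y).
Proof.
  intros Hh HF.
  apply (BUC_eq (fun x y => 2 * iter_avg p h (F x) y + (-1) * iter_avg p (2 * h) (F x) y)).
  - intros. unfold steklov. ring.
  - apply BUC_lincomb; apply BUC_iter_avg; auto; lra.
Qed.

(** Averaging in the first variable commutes with differentiation in the second.
    This replaces an interchange of integrations when the partial derivatives of a
    mean in both variables are computed. *)
Lemma is_derive_avg_param (h : R) (H H' : R -> R -> R) (x y : R) :
  BUC H -> BUC H' -> (forall x y, is_derive (H x) y (H' x y)) ->
  is_derive (fun v => avg h (fun u => H u v) x) y (avg h (fun u => H' u y) x).
Proof.
  intros HH HH' HD. unfold avg.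
  assert (E : forall z t, Derive (fun v => H (x + h * t) v) z = H' (x + h * t) z).
  { intros z t. apply is_derive_unique. apply HD. }
  replace (RInt (fun s => H' (x + h * s) y) 0 1)
    with (RInt (fun s => Derive (fun v => H (x + h * s) v) y) 0 1).
  2: { apply (RInt_ext (V := R_CompleteNormedModule)). intros; apply E. }
  apply (is_derive_RInt_param (fun v s => H (x + h * s) v)).
  - apply filter_forall. intros z t _. exists (H' (x + h * t) z). apply HD.
  - intros t _. apply continuity_2d_pt_ext with (fun u v => H' (x + h * v) u).
    { intros u v. symmetry. apply E. }
    destruct HH' as [_ HU]. intros [eps He]; simpl.
    destruct (HU (eps / 2)) as [eta [Heta H1]]; [lra|].
    assert (Hk : 0 < eta / (Rabs h + 1)).
    { apply Rdiv_lt_0_compat; auto. pose proof (Rabs_pos h); lra. }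
    exists (mkposreal _ (Rmin_pos _ _ Heta Hk)). simpl. intros u v Hu Hv.
    apply Rle_lt_trans with (eps / 2); [|lra]. apply H1.
    + replace (x + h * v - (x + h * t)) with (h * (v - t)) by ring.
      rewrite Rabs_mult. pose proof (Rabs_pos h). pose proof (Rabs_pos (v - t)).
      assert (Hv' : Rabs (v - t) < eta / (Rabs h + 1)) by (eapply Rlt_le_trans; [exact Hv|apply Rmin_r]).
      apply Rle_lt_trans with ((Rabs h + 1) * Rabs (v - t)); [nra|].
      replace eta with ((Rabs h + 1) * (eta / (Rabs h + 1))) by (field; lra).
      apply Rmult_lt_compat_l; lra.
    + eapply Rlt_le_trans; [exact Hu|apply Rmin_l].
  - apply filter_forall. intros z.
    apply (ex_RInt_avg (fun u => H u z)). intros t. now apply BUC_continuous_l.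
Qed.

Lemma is_derive_steklov0_param (h : R) (H H' : R -> R -> R) (x y : R) :
  0 < h -> BUC H -> BUC H' -> (forall x y, is_derive (H x) y (H' x y)) ->
  is_derive (fun v => steklov 0 h (fun u => H u v) x) y (steklov 0 h (fun u => H' u y) x).
Proof.
  intros Hh HH HH' HD.
  assert (A : forall k, 0 < k -> is_derive (fun v => avg k (avg k (fun u => H u v)) x) y
     (avg k (avg k (fun u => H' u y)) x)).
  { intros k Hk. apply (is_derive_avg_param k (fun u v => avg k (fun w => H w v) u)
      (fun u v => avg k (fun w => H' w v) u)).
    - apply (BUC_swap (fun v u => avg k (fun w => H w v) u)).
      apply (BUC_avg k (fun v w => H w v)); auto. now apply BUC_swap.
    - apply (BUC_swap (fun v u => avg k (fun w => H' w v) u)).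
      apply (BUC_avg k (fun v w => H' w v)); auto. now apply BUC_swap.
    - intros u v. now apply is_derive_avg_param. }
  unfold steklov; simpl iter_avg.
  apply (is_derive_minus (fun v => 2 * avg h (avg h (fun u => H u v)) x)
    (fun v => avg (2 * h) (avg (2 * h) (fun u => H u v)) x)).
  - apply is_derive_scal. now apply A.
  - apply A. lra.
Qed.

Section Steklov_xy.
Variables (F : R -> R -> R) (h : R).
Hypotheses (HF : BUC F) (Hh : 0 < h).

Definition steklov_y (q : nat) (x y : R) : R := steklov q h (F x) y.
(** Derivatives of order [p] and [q] of the mean of [F] taken first in the second
    variable and then in the first. *)
Definition steklov_xy (p q : nat) (x y : R) : R := steklov p h (fun u => steklov_y q u y) x.

Lemma BUC_steklov_y (q : nat) : BUC (steklov_y q).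
Proof. now apply BUC_steklov. Qed.

Lemma BUC_steklov_xy (p q : nat) : BUC (steklov_xy p q).
Proof.
  apply (BUC_swap (fun y x => steklov p h (fun u => steklov_y q u y) x)).
  apply (BUC_steklov p h (fun y u => steklov_y q u y)); auto.
  apply BUC_swap, BUC_steklov_y.
Qed.

Lemma steklov_xy_dy (q : nat) (x y : R) :
  (q < 2)%nat -> is_derive (fun v => steklov_xy 0 q x v) y (steklov_xy 0 (S q) x y).
Proof.
  intros Hq. apply is_derive_steklov0_param; auto; try apply BUC_steklov_y.
  intros u v. apply is_derive_steklov; auto. now apply BUC_continuous.
Qed.

Lemma steklov_xy_dx (p q : nat) (x y : R) :
  (p < 2)%nat -> is_derive (fun u => steklov_xy p q u y) x (steklov_xy (S p) q x y).
Proof.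
  intros Hp. apply (is_derive_steklov p (fun u => steklov_y q u y)); auto.
  intros t. apply BUC_continuous_l, BUC_steklov_y.
Qed.

Lemma CB2_steklov_xy : CB2 (steklov_xy 0 0).
Proof.
  apply CB2_family.
  - apply BUC_steklov_xy.
  - intros; now apply steklov_xy_dy.
  - intros; now apply steklov_xy_dx.
Qed.

Lemma steklov_xy_bound (B : R) :
  (forall x y, inI x y -> Rabs (F x y) <= B) ->
  forall x y, inI x y -> Rabs (steklov_xy 0 0 x y) <= 9 * B.
Proof.
  intros HB x y [Hx Hy]. replace (9 * B) with (3 * (3 * B)) by ring.
  apply (steklov0_bound (fun u => steklov_y 0 u y)); auto.
  - intros t. apply BUC_continuous_l, BUC_steklov_y.
  - intros u Hu. apply (steklov0_bound (F u)); auto.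
    + now apply BUC_continuous.
    + intros t Ht. apply HB. now split.
Qed.

Variable w : R.
Hypothesis Hwx : forall s x y, 0 <= s <= 2 * h -> inI x y -> Rabs (diff2 s (fun u => F u y) x) <= w.
Hypothesis Hwy : forall s x y, 0 <= s <= 2 * h -> inI x y -> Rabs (diff2 s (F x) y) <= w.

(** Differences in the first variable commute with averaging in the second, so
    they grow at most by the norm 3 of the averaging operator. *)
Lemma steklov_y_diff2 (s x y : R) :
  0 <= s <= 2 * h -> inI x y -> Rabs (diff2 s (fun u => steklov_y 0 u y) x) <= 3 * w.
Proof.
  intros Hs [Hx Hy]. unfold diff2, steklov_y.
  assert (HC : forall u t, continuous (F u) t) by (intros; now apply BUC_continuous).
  rewrite steklov0_diff2 by auto.
  apply steklov0_bound; auto.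
  - intros t. apply (continuous_plus (fun t => F (x + 2 * s) t - 2 * F (x + s) t) (F x)); auto.
    apply (continuous_minus (F (x + 2 * s)) (fun t => 2 * F (x + s) t)); auto.
    now apply (continuous_scal_r 2 (F (x + s))).
  - intros t Ht. apply (Hwx s x t); auto. now split.
Qed.

Lemma steklov_xy_error (x y : R) : inI x y -> Rabs (steklov_xy 0 0 x y - F x y) <= 4 * w.
Proof.
  intros [Hx Hy].
  assert (E1 : Rabs (steklov_xy 0 0 x y - steklov_y 0 x y) <= 3 * w).
  { apply (steklov0_error (fun u => steklov_y 0 u y)); auto.
    - intros t. apply BUC_continuous_l, BUC_steklov_y.
    - intros s t Hs Ht. apply steklov_y_diff2; auto. now split. }
  assert (E2 : Rabs (steklov_y 0 x y - F x y) <= w).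
  { apply (steklov0_error (F x)); auto.
    - now apply BUC_continuous.
    - intros s t Hs Ht. apply Hwy; auto. now split. }
  apply Rabs_le_between in E1, E2. apply Rabs_le. lra.
Qed.

Lemma steklov_xy_xx_bound (x y : R) : inI x y -> (2 * h) ^ 2 * Rabs (steklov_xy 2 0 x y) <= 27 * w.
Proof.
  intros [Hx Hy]. replace (27 * w) with (9 * (3 * w)) by ring.
  apply (steklov2_bound (fun u => steklov_y 0 u y)); auto.
  intros s t Hs Ht. apply steklov_y_diff2; auto. now split.
Qed.

Lemma steklov_xy_yy_bound (x y : R) : inI x y -> (2 * h) ^ 2 * Rabs (steklov_xy 0 2 x y) <= 27 * w.
Proof.
  intros [Hx Hy].
  assert (Hp : 0 < (2 * h) ^ 2) by nra.
  assert (HB : forall u, 0 <= u -> Rabs (steklov_y 2 u y) <= 9 * w / (2 * h) ^ 2).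
  { intros u Hu. apply (Rmult_le_reg_l ((2 * h) ^ 2)); auto.
    replace ((2 * h) ^ 2 * (9 * w / (2 * h) ^ 2)) with (9 * w) by (field; lra).
    apply (steklov2_bound (F u)); auto.
    intros s t Hs Ht. apply Hwy; auto. now split. }
  pose proof (steklov0_bound (fun u => steklov_y 2 u y) h _
    (fun t => BUC_continuous_l _ (BUC_steklov_y 2) t y) Hh HB x Hx) as H.
  apply (Rmult_le_compat_l ((2 * h) ^ 2)) in H; [|lra].
  eapply Rle_trans; [exact H|]. right. field. lra.
Qed.
End Steklov_xy.

(** The constant: [4 w] from the error, [4 * 27 w] from the second derivatives
    (each counted twice, because of the interpolated first derivatives) and
    [5 * 9] times [d ||f||] from the norm of the mean. *)
Lemma Kfunctional_le_omega2 (f : R -> R -> R) (d : R) :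
  CB f -> 0 < d ->
  Kfunctional f d <= 112 * (omega2 f (sqrt d) + Rmin 1 d * normCB f).
Proof.
  intros Hf Hd. pose proof (normCB_nonneg f) as Hn.
  pose proof (omega2_nonneg f (sqrt d)) as Hw0.
  destruct (Rle_dec 1 d) as [H1|H1].
  { rewrite Rmin_left by auto.
    pose proof (Kfunctional_le_norm f d Hf ltac:(lra)). lra. }
  rewrite Rmin_right by lra.
  set (h := sqrt d / 2). set (w := omega2 f (sqrt d)) in *.
  assert (Hs : 0 < sqrt d) by now apply sqrt_lt_R0.
  assert (Hh : 0 < h) by (unfold h; lra).
  assert (H2h : 2 * h = sqrt d) by (unfold h; lra).
  assert (Hd2 : (2 * h) ^ 2 = d) by (rewrite H2h; apply pow2_sqrt; lra).
  pose proof (BUC_ext f Hf) as HF.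
  assert (Hwx : forall s x y, 0 <= s <= 2 * h -> inI x y ->
     Rabs (diff2 s (fun u => ext f u y) x) <= w).
  { intros s x y Hss [Hx Hy]. unfold diff2.
    destruct (Req_dec s 0) as [->|Hs0].
    - replace (x + 2 * 0) with x by ring. rewrite Rplus_0_r.
      replace (_ + _) with 0 by ring. now rewrite Rabs_R0.
    - rewrite !ext_inI by (split; lra).
      pose proof (omega2_upper f (sqrt d) x y s 0) as H.
      rewrite Rmult_0_r, Rplus_0_r in H. apply H; try (split; lra); [apply Hf|].
      replace (s ^ 2 + 0 ^ 2) with (s ^ 2) by ring. rewrite sqrt_pow2 by lra. lra. }
  assert (Hwy : forall s x y, 0 <= s <= 2 * h -> inI x y ->
     Rabs (diff2 s (ext f x) y) <= w).
  { intros s x y Hss [Hx Hy]. unfold diff2.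
    destruct (Req_dec s 0) as [->|Hs0].
    - replace (y + 2 * 0) with y by ring. rewrite Rplus_0_r.
      replace (_ + _) with 0 by ring. now rewrite Rabs_R0.
    - rewrite !ext_inI by (split; lra).
      pose proof (omega2_upper f (sqrt d) x y 0 s) as H.
      rewrite Rmult_0_r, Rplus_0_r in H. apply H; try (split; lra); [apply Hf|].
      replace (0 ^ 2 + s ^ 2) with (s ^ 2) by ring. rewrite sqrt_pow2 by lra. lra. }
  set (g := steklov_xy (ext f) h 0 0).
  assert (Hg : CB2 g) by now apply CB2_steklov_xy.
  assert (P : forall p q x y, (p <= 2)%nat -> (q <= 2)%nat -> inI x y ->
     partialI p q g x y = steklov_xy (ext f) h p q x y).
  { intros p q x y Hp Hq Hxy. apply (partialI_family (steklov_xy (ext f) h)); auto.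
    - intros; now apply steklov_xy_dy.
    - intros; now apply steklov_xy_dx. }
  assert (A0 : normCB (fun x y => f x y - g x y) <= 4 * w).
  { apply normCB_least. intros x y Hxy. rewrite Rabs_minus_sym, <- (ext_inI f) by auto.
    now apply steklov_xy_error. }
  assert (A1 : normCB g <= 9 * normCB f).
  { apply normCB_least. intros x y Hxy. apply steklov_xy_bound; auto.
    intros u v Huv. rewrite ext_inI by auto. apply normCB_upper; auto. apply Hf. }
  assert (D : forall k u, 0 <= k -> (2 * h) ^ 2 * u <= k -> u <= k / d).
  { intros k u Hk Hu. rewrite Hd2 in Hu. apply (Rmult_le_reg_l d); auto.
    replace (d * (k / d)) with k by (field; lra). auto. }
  assert (A2 : normCB (partialI 2 0 g) <= 27 * w / d).
  { apply normCB_least. intros x y Hxy. rewrite P by auto.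
    apply D; [lra|]. now apply steklov_xy_xx_bound. }
  assert (A3 : normCB (partialI 0 2 g) <= 27 * w / d).
  { apply normCB_least. intros x y Hxy. rewrite P by auto.
    apply D; [lra|]. now apply steklov_xy_yy_bound. }
  pose proof (Kfunctional_le f g d ltac:(lra) Hg) as K.
  pose proof (normCB2_le g Hg) as N.
  assert (N2 : d * normCB2 g <= 45 * d * normCB f + 108 * w).
  { apply Rle_trans with (d * (45 * normCB f + 4 * (27 * w / d))).
    - apply Rmult_le_compat_l; lra.
    - right. field. lra. }
  pose proof (Rmult_le_pos d (normCB f) ltac:(lra) Hn). nra.
Qed.

(** * Moments of the weights *)

Lemma is_series_ext_R (u v : nat -> R) (l : R) :
  (forall k, u k = v k) -> is_series u l -> is_series v l.
Proof. exact (is_series_ext u v l). Qed.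

Lemma is_series_scal_R (c : R) (u : nat -> R) (l : R) :
  is_series u l -> is_series (fun k => c * u k) (c * l).
Proof. exact (is_series_scal c u l). Qed.

Lemma is_series_shift (u : nat -> R) (l : R) :
  u O = 0 -> is_series (fun k => u (S k)) l -> is_series u l.
Proof.
  intros H0 H. apply (is_series_decr_1 u). rewrite H0.
  refine (eq_ind l (is_series (fun k => u (S k))) H _ _).
  change (l = l + - 0). ring.
Qed.

Lemma pochhammer_succ_l (n k : nat) :
  pochhammer n (S k) = INR n * pochhammer (S n) k.
Proof.
  induction k as [|k IH].
  - simpl. rewrite Nat.add_0_r. ring.
  - change (pochhammer n (S (S k))) with (pochhammer n (S k) * INR (n + S k)).
    rewrite IH. simpl pochhammer.
    replace (n + S k)%nat with (S n + k)%nat by lia. simpl. ring.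
Qed.

Lemma pochhammer_nonneg (n k : nat) : 0 <= pochhammer n k.
Proof.
  induction k as [|k IH]; simpl; [lra|].
  apply Rmult_le_pos; [exact IH | apply pos_INR].
Qed.

(** The binomial coefficient [C (n + k - 1, k)], with the convention for [n = 0]
    that makes it the coefficient of the constant series 1. *)
Definition nb_coef (n k : nat) : R := pochhammer n k / INR (Factorial.fact k).

Lemma nb_coef_nonneg (n k : nat) : 0 <= nb_coef n k.
Proof.
  apply Rdiv_le_0_compat; [apply pochhammer_nonneg | apply INR_fact_lt_0].
Qed.

(** Multiplication of the generating function by [1 / (1 - t)] takes partial
    sums of the coefficients and raises [n] by one. *)
Lemma nb_coef_hockey_stick (n k : nat) :
  sum_f_R0 (nb_coef n) k = nb_coef (S n) k.
Proof.
  induction k as [|k IH].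
  - unfold nb_coef; simpl; lra.
  - rewrite tech5, IH. unfold nb_coef. rewrite pochhammer_succ_l.
    change (pochhammer (S n) (S k)) with (pochhammer (S n) k * INR (S n + k)).
    rewrite fact_simpl, mult_INR, plus_INR, !S_INR.
    field. split; [apply INR_fact_neq_0 |]. pose proof (pos_INR k); lra.
Qed.

Lemma is_series_nb_coef (n : nat) (t : R) :
  Rabs t < 1 -> is_series (fun k => nb_coef n k * t ^ k) (/ (1 - t) ^ n).
Proof.
  revert t. induction n as [|n IH]; intros t Ht.
  - simpl. rewrite Rinv_1.
    apply filterlim_ext with (fun _ : nat => 1); [|apply filterlim_const].
    intros k. induction k as [|k IH].
    + rewrite sum_O. unfold nb_coef; simpl; lra.
    + rewrite sum_Sn, <- IH. unfold nb_coef. rewrite pochhammer_succ_l.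
      unfold plus; simpl. lra.
  - assert (H1 : t < 1) by (apply Rabs_def2 in Ht; lra).
    assert (Hn : 1 - t <> 0) by lra.
    replace (/ (1 - t) ^ S n) with (/ (1 - t) ^ n * / (1 - t)).
    2: { simpl. field. split; [apply pow_nonzero|]; lra. }
    apply is_series_ext with
      (fun k => sum_f_R0 (fun i => (nb_coef n i * t ^ i) * t ^ (k - i)) k).
    + intros k. rewrite <- nb_coef_hockey_stick, (Rmult_comm _ (t ^ k)), scal_sum.
      apply sum_eq. intros i Hi.
      replace (t ^ k) with (t ^ i * t ^ (k - i)); [ring|].
      rewrite <- pow_add. f_equal. lia.
    + apply is_series_mult.
      * now apply IH.
      * now apply is_series_geom.
      * exists (/ (1 - Rabs t) ^ n).
        apply is_series_ext with (fun k => nb_coef n k * Rabs t ^ k).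
        -- intros k. rewrite Rabs_mult, <- RPow_abs, (Rabs_pos_eq (nb_coef n k)); auto.
           apply nb_coef_nonneg.
        -- apply IH. now rewrite Rabs_Rabsolu.
      * exists (/ (1 - Rabs t)).
        apply is_series_ext with (fun k => Rabs t ^ k).
        -- intros k. apply RPow_abs.
        -- apply is_series_geom. now rewrite Rabs_Rabsolu.
Qed.

Definition Ppoly_coef (a : R) (n k : nat) : R := Ppoly k n a / INR (Factorial.fact k).

Lemma Ppoly_coef_convolution (a : R) (n k : nat) :
  Ppoly_coef a n k =
  sum_f_R0 (fun i => nb_coef n i * (/ INR (Factorial.fact (k - i)) * a ^ (k - i))) k.
Proof.
  unfold Ppoly_coef, Ppoly, Rdiv. rewrite Rmult_comm, scal_sum.
  apply sum_eq. intros i Hi. unfold Binomial.C, nb_coef.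
  field. repeat split; apply INR_fact_neq_0.
Qed.

Definition Ppoly_genfun (a : R) (n : nat) (t : R) : R := exp (a * t) * / (1 - t) ^ n.

Lemma is_series_exp (z : R) :
  is_series (fun k => / INR (Factorial.fact k) * z ^ k) (exp z).
Proof. apply is_pseries_R, is_exp_Reals. Qed.

Lemma is_series_Ppoly_coef (a : R) (n : nat) (t : R) :
  Rabs t < 1 -> is_series (fun k => Ppoly_coef a n k * t ^ k) (Ppoly_genfun a n t).
Proof.
  intros Ht. unfold Ppoly_genfun. rewrite Rmult_comm.
  apply is_series_ext with
    (fun k => sum_f_R0 (fun i => (nb_coef n i * t ^ i) *
       (/ INR (Factorial.fact (k - i)) * (a * t) ^ (k - i))) k).
  - intros k. rewrite Ppoly_coef_convolution, (Rmult_comm _ (t ^ k)), scal_sum.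
    apply sum_eq. intros i Hi. rewrite Rpow_mult_distr.
    replace (t ^ k) with (t ^ i * t ^ (k - i)); [ring|].
    rewrite <- pow_add. f_equal. lia.
  - apply (is_series_mult (fun i => nb_coef n i * t ^ i)
      (fun j => / INR (Factorial.fact j) * (a * t) ^ j)).
    + now apply is_series_nb_coef.
    + apply is_series_exp.
    + exists (/ (1 - Rabs t) ^ n).
      apply is_series_ext with (fun k => nb_coef n k * Rabs t ^ k).
      * intros k. rewrite Rabs_mult, <- RPow_abs, (Rabs_pos_eq (nb_coef n k)); auto.
        apply nb_coef_nonneg.
      * apply is_series_nb_coef. now rewrite Rabs_Rabsolu.
    + exists (exp (Rabs (a * t))).
      apply is_series_ext with (fun k => / INR (Factorial.fact k) * Rabs (a * t) ^ k).
      * intros k. rewrite (Rabs_mult (/ _)), <- RPow_abs, (Rabs_pos_eq (/ _)); auto.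
        left. apply Rinv_0_lt_compat, INR_fact_lt_0.
      * apply is_series_exp.
Qed.

(** Terms of a convergent series tend to 0, which fails beyond the radius of
    convergence. *)
Lemma CV_radius_ge_1 (c : nat -> R) :
  (forall t, Rabs t < 1 -> ex_series (fun k => c k * t ^ k)) ->
  Rbar_le 1 (CV_radius c).
Proof.
  intros H. apply Rbar_not_lt_le. intros Hlt.
  assert (Hr : exists r : R, Rbar_lt (CV_radius c) r /\ 0 <= r < 1).
  { pose proof (CV_radius_ge_0 c) as H0.
    destruct (CV_radius c) as [r| |]; simpl in *; try tauto.
    (* a point strictly between the radius and 1 *)
    exists ((r + 1) / 2). simpl. lra. }
  destruct Hr as [r [Hr [H0 H1]]].
  apply (CV_disk_outside c r).
  - rewrite Rabs_pos_eq; auto.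
  - apply ex_series_lim_0, H. rewrite Rabs_pos_eq; auto.
Qed.

(** Termwise differentiation of a power series whose sum on the open unit disc is
    known. *)
Lemma is_series_derive (c : nat -> R) (F F' : R -> R) :
  (forall t, Rabs t < 1 -> is_series (fun k => c k * t ^ k) (F t)) ->
  (forall t, Rabs t < 1 -> is_derive F t (F' t)) ->
  forall t, Rabs t < 1 -> is_series (fun k => INR (S k) * c (S k) * t ^ k) (F' t).
Proof.
  intros HF HF' t Ht.
  assert (HR : Rbar_lt (Rabs t) (CV_radius c)).
  { apply Rbar_lt_le_trans with 1; [exact Ht|].
    apply CV_radius_ge_1. intros s Hs. exists (F s). auto. }
  assert (HE : locally t (fun s => PSeries c s = F s)).
  { assert (Hd : 0 < 1 - Rabs t) by lra.
    exists (mkposreal _ Hd). intros s Hs. apply is_series_unique.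
    apply HF. assert (Hs' : Rabs (s - t) < 1 - Rabs t) by exact Hs.
    pose proof (Rabs_triang_inv s t). lra. }
  assert (HD : PSeries (PS_derive c) t = F' t).
  { apply (is_derive_PSeries c t) in HR as HD1.
    apply (is_derive_ext_loc _ F) in HD1; [|exact HE].
    rewrite <- (is_derive_unique _ _ _ HD1). apply is_derive_unique. auto. }
  rewrite <- HD.
  assert (HX : ex_pseries (PS_derive c) t).
  { apply CV_radius_inside. now rewrite CV_radius_derive. }
  apply PSeries_correct in HX. apply is_pseries_R in HX. exact HX.
Qed.

Lemma is_derive_Ppoly_genfun (a : R) (n : nat) (t : R) :
  Rabs t < 1 -> is_derive (Ppoly_genfun a n) t ((a + INR n / (1 - t)) * Ppoly_genfun a n t).
Proof.
  intros Ht. apply Rabs_def2 in Ht. assert (Hn : 1 - t <> 0) by lra.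
  unfold Ppoly_genfun. auto_derive; [now apply pow_nonzero|].
  destruct n as [|n].
  - simpl. field; auto.
  - simpl pred. change (1 + - t) with (1 - t).
    change ((1 - t) ^ S n) with ((1 - t) * (1 - t) ^ n).
    assert ((1 - t) ^ n <> 0) by now apply pow_nonzero.
    field; auto.
Qed.

Lemma is_derive2_Ppoly_genfun (a : R) (n : nat) (t : R) :
  Rabs t < 1 ->
  is_derive (fun s => (a + INR n / (1 - s)) * Ppoly_genfun a n s) t
    ((INR n / (1 - t) ^ 2 + (a + INR n / (1 - t)) ^ 2) * Ppoly_genfun a n t).
Proof.
  intros Ht. pose proof (is_derive_Ppoly_genfun a n t Ht) as H1.
  apply Rabs_def2 in Ht. assert (Hn : 1 - t <> 0) by lra.
  assert (H2 : is_derive (fun s => a + INR n / (1 - s)) t (INR n / (1 - t) ^ 2)).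
  { auto_derive; auto. field; auto. }
  evar_last.
  - apply (is_derive_mult _ _ _ _ _ H2 H1). intros; apply Rmult_comm.
  - unfold plus, mult; simpl. ring.
Qed.

(** The weights are the terms of the generating series at [t = x / (1 + x)],
    divided by its sum. *)
Lemma W_Ppoly_coef (a x : R) (n k : nat) :
  0 <= x ->
  W a n k x = exp (- (a * x / (1 + x))) / (1 + x) ^ n * (Ppoly_coef a n k * (x / (1 + x)) ^ k).
Proof.
  intros Hx. unfold W, Ppoly_coef. rewrite pow_add.
  unfold Rdiv. rewrite Rpow_mult_distr, pow_inv, !Rinv_mult. ring.
Qed.

Lemma Ppoly_coef_nonneg (a : R) (n k : nat) : 0 <= a -> 0 <= Ppoly_coef a n k.
Proof.
  intros Ha. rewrite Ppoly_coef_convolution. apply cond_pos_sum. intros i.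
  apply Rmult_le_pos; [apply nb_coef_nonneg|].
  apply Rmult_le_pos; [|now apply pow_le].
  left. apply Rinv_0_lt_compat, INR_fact_lt_0.
Qed.

Lemma W_nonneg (a x : R) (n k : nat) : 0 <= a -> 0 <= x -> 0 <= W a n k x.
Proof.
  intros Ha Hx. rewrite W_Ppoly_coef; auto.
  apply Rmult_le_pos; [apply Rdiv_le_0_compat|apply Rmult_le_pos].
  - left; apply exp_pos.
  - apply pow_lt; lra.
  - now apply Ppoly_coef_nonneg.
  - apply pow_le, Rdiv_le_0_compat; lra.
Qed.

Definition W_mean (a : R) (n : nat) (x : R) : R := INR n * x + a * x / (1 + x).

Section W_moments.
Variables (a x : R) (n : nat).
Hypothesis Hx : 0 <= x.

Let t := x / (1 + x).
Let c := exp (- (a * x / (1 + x))) / (1 + x) ^ n.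

Let t_lt_1 : Rabs t < 1.
Proof.
  unfold t. rewrite Rabs_pos_eq; [|apply Rdiv_le_0_compat; lra].
  apply (Rmult_lt_reg_r (1 + x)); [lra|]. field_simplify; lra.
Qed.

Let c_genfun : c * Ppoly_genfun a n t = 1.
Proof.
  unfold c, Ppoly_genfun. replace (1 - t) with (/ (1 + x)) by (unfold t; field; lra).
  rewrite pow_inv, Rinv_inv.
  assert (He : exp (- (a * x / (1 + x))) * exp (a * t) = 1).
  { rewrite <- exp_plus. transitivity (exp 0); [|apply exp_0].
    f_equal. unfold t. field. lra. }
  assert (Hp : (1 + x) ^ n <> 0) by (apply pow_nonzero; lra).
  transitivity (exp (- (a * x / (1 + x))) * exp (a * t)); [|exact He].
  revert Hp. generalize ((1 + x) ^ n) (exp (a * t)).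
  intros p e Hp. field; auto.
Qed.

Lemma W_total_mass : is_series (fun k => W a n k x) 1.
Proof.
  rewrite <- c_genfun.
  apply is_series_ext with (fun k => c * (Ppoly_coef a n k * t ^ k)).
  - intros k. now rewrite W_Ppoly_coef.
  - apply (is_series_scal_R c _ _ (is_series_Ppoly_coef a n t t_lt_1)).
Qed.

Lemma W_first_moment : is_series (fun k => W a n k x * INR k) (W_mean a n x).
Proof.
  pose proof (is_series_derive (Ppoly_coef a n) _ _ (is_series_Ppoly_coef a n)
    (is_derive_Ppoly_genfun a n) t t_lt_1) as H.
  apply (is_series_scal_R (c * t)) in H.
  apply is_series_shift; [simpl; ring|].
  replace (W_mean a n x) with (c * t * ((a + INR n / (1 - t)) * Ppoly_genfun a n t)).
  - eapply is_series_ext_R; [|exact H].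
    intros k. rewrite W_Ppoly_coef; auto. fold t c. simpl pow. ring.
  - transitivity (t * (a + INR n / (1 - t)) * (c * Ppoly_genfun a n t)); [ring|].
    rewrite c_genfun. unfold W_mean, t. field. lra.
Qed.

Lemma W_second_factorial_moment :
  is_series (fun k => W a n k x * (INR k * (INR k - 1))) (W_mean a n x ^ 2 + INR n * x ^ 2).
Proof.
  pose proof (is_series_derive _ _ _
    (is_series_derive (Ppoly_coef a n) _ _ (is_series_Ppoly_coef a n) (is_derive_Ppoly_genfun a n))
    (is_derive2_Ppoly_genfun a n) t t_lt_1) as H.
  apply (is_series_scal_R (c * t ^ 2)) in H.
  apply is_series_shift; [simpl; ring|].
  apply is_series_shift; [simpl; ring|].
  match type of H with is_series _ ?l =>
    replace (W_mean a n x ^ 2 + INR n * x ^ 2) with l end.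
  - eapply is_series_ext_R; [|exact H].
    intros k. rewrite W_Ppoly_coef; auto. fold t c. rewrite (S_INR (S k)). simpl pow. ring.
  - transitivity (t ^ 2 * (INR n / (1 - t) ^ 2 + (a + INR n / (1 - t)) ^ 2) * (c * Ppoly_genfun a n t));
      [ring|].
    rewrite c_genfun. unfold W_mean, t. field. lra.
Qed.
End W_moments.

(** * The one-variable operator *)

Lemma is_series_plus_R (u v : nat -> R) (k l : R) :
  is_series u k -> is_series v l -> is_series (fun i => u i + v i) (k + l).
Proof. exact (is_series_plus u v k l). Qed.

(** In probabilistic terms: if [s] differs from an affine function of a centred
    variable [c] by at most [D + C d], the mean of [s] differs from the constant
    term by at most [D + C V]. *)
Lemma weighted_sum_bound (w s c d : nat -> R) (V A B C D : R) :
  (forall k, 0 <= w k) -> is_series w 1 ->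
  is_series (fun k => w k * c k) 0 -> is_series (fun k => w k * d k) V ->
  (forall k, Rabs (s k - A - B * c k) <= D + C * d k) ->
  ex_series (fun k => w k * s k) /\ Rabs (Series (fun k => w k * s k) - A) <= D + C * V.
Proof.
  intros Hw H1 Hc Hd Hs.
  set (r := fun k => w k * (s k - A - B * c k)).
  set (b := fun k => D * w k + C * (w k * d k)).
  assert (Hb : is_series b (D + C * V)).
  { replace (D + C * V) with (D * 1 + C * V) by ring.
    apply is_series_plus_R; now apply is_series_scal_R. }
  assert (Hrb : forall k, Rabs (r k) <= b k).
  { intros k. unfold r, b. rewrite Rabs_mult, Rabs_pos_eq by auto.
    replace (D * w k + C * (w k * d k)) with (w k * (D + C * d k)) by ring.
    apply Rmult_le_compat_l; auto. }
  assert (Har : ex_series (fun k => Rabs (r k))).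
  { apply (ex_series_le (K := R_AbsRing) (V := R_CompleteNormedModule) _ b); [|now exists (D + C * V)].
    intros k. change (Rabs (Rabs (r k)) <= b k). now rewrite Rabs_Rabsolu. }
  assert (Hr : is_series r (Series r)) by (apply Series_correct, ex_series_Rabs, Har).
  assert (HR : Rabs (Series r) <= D + C * V).
  { eapply Rle_trans; [apply Series_Rabs, Har|].
    rewrite <- (is_series_unique _ _ Hb). apply Series_le; [|now exists (D + C * V)].
    intros k. split; [apply Rabs_pos|auto]. }
  assert (HS : is_series (fun k => w k * s k) (Series r + (A * 1 + B * 0))).
  { apply is_series_ext_R with (fun k => r k + (A * w k + B * (w k * c k))).
    - intros k. unfold r. ring.
    - apply is_series_plus_R; auto. apply is_series_plus_R; now apply is_series_scal_R. }
  split; [eexists; exact HS|].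
  rewrite (is_series_unique _ _ HS).
  now replace (Series r + (A * 1 + B * 0) - A) with (Series r) by ring.
Qed.

(** The mean value of [phi] over the [k]-th cell, whose length is [1 / (n + 1)]. *)
Definition cell_average (n k : nat) (phi : R -> R) : R :=
  INR (n + 1) * RInt phi (node n k) (node n (k + 1)).

Definition cell_center (n k : nat) : R := (INR k + 1 / 2) / INR (n + 1).

(** The mean over the [k]-th cell of [(u - m) ^ 2]; the second summand is the
    variance of the uniform law on the cell. *)
Definition cell_second_moment (n k : nat) (m : R) : R :=
  (cell_center n k - m) ^ 2 + 1 / (12 * INR (n + 1) ^ 2).

Lemma INR_n1_pos (n : nat) : 0 < INR (n + 1).
Proof. apply lt_0_INR. lia. Qed.

Lemma cell_average_bound (n k : nat) (phi : R -> R) (m A B C D : R) :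
  (forall t, continuous phi t) ->
  (forall u, 0 <= u -> Rabs (phi u - A - B * (u - m)) <= D + C * (u - m) ^ 2) ->
  Rabs (cell_average n k phi - A - B * (cell_center n k - m)) <= D + C * cell_second_moment n k m.
Proof.
  intros Hphi Hb. pose proof (INR_n1_pos n) as HN.
  set (N := INR (n + 1)) in *. set (p := node n k). set (q := node n (k + 1)).
  assert (Hp : 0 <= p) by (apply Rdiv_le_0_compat; [apply pos_INR|exact HN]).
  assert (Hpq : q = p + / N) by (unfold p, q, node; rewrite plus_INR; simpl; fold N; field; lra).
  assert (HiN : 0 < / N) by now apply Rinv_0_lt_compat.
  assert (I1 := RInt_correct (V := R_CompleteNormedModule) phi p q (ex_RInt_cont _ _ _ Hphi)).
  pose (l2 := (A * q + B * (q - m) ^ 2 / 2) - (A * p + B * (p - m) ^ 2 / 2)).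
  pose (l3 := (D * q + C * (q - m) ^ 3 / 3) - (D * p + C * (p - m) ^ 3 / 3)).
  assert (I2 : is_RInt (fun u => A + B * (u - m)) p q l2).
  { apply (is_RInt_derive (V := R_CompleteNormedModule) (fun u => A * u + B * (u - m) ^ 2 / 2)).
    - intros u _. auto_derive; auto. field.
    - intros u _. apply (ex_derive_continuous (V := R_NormedModule)). auto_derive; auto. }
  assert (I3 : is_RInt (fun u => D + C * (u - m) ^ 2) p q l3).
  { apply (is_RInt_derive (V := R_CompleteNormedModule) (fun u => D * u + C * (u - m) ^ 3 / 3)).
    - intros u _. auto_derive; auto. field.
    - intros u _. apply (ex_derive_continuous (V := R_NormedModule)). auto_derive; auto. }
  assert (HL : Rabs (RInt phi p q - l2) <= l3).
  { apply (norm_RInt_le (V := R_NormedModule) (fun u => phi u - (A + B * (u - m)))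
      (fun u => D + C * (u - m) ^ 2) p q (RInt phi p q - l2) l3); auto; [lra| |].
    - intros u Hu. change (Rabs (phi u - (A + B * (u - m))) <= D + C * (u - m) ^ 2).
      replace (phi u - (A + B * (u - m))) with (phi u - A - B * (u - m)) by ring.
      apply Hb. lra.
    - exact (is_RInt_minus (V := R_NormedModule) _ _ _ _ _ _ I1 I2). }
  unfold l2, l3 in HL.
  unfold cell_average. fold N p q.
  assert (Ec : cell_center n k = p + / N / 2).
  { unfold cell_center, p, node. fold N. field. lra. }
  unfold cell_second_moment. rewrite Ec. fold N.
  apply (Rmult_le_compat_l N) in HL; [|lra].
  rewrite <- (Rabs_pos_eq N) in HL at 1 by lra. rewrite <- Rabs_mult in HL.
  rewrite Hpq in HL at 2 3 4 5.
  replace (N * (RInt phi p q - (A * (p + / N) + B * (p + / N - m) ^ 2 / 2 - (A * p + B * (p - m) ^ 2 / 2))))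
    with (N * RInt phi p q - A - B * (p + / N / 2 - m)) in HL by (field; lra).
  eapply Rle_trans; [exact HL|]. right. field. lra.
Qed.

(** The image of the identity function under the one-variable operator. *)
Definition kant_mean (a : R) (n : nat) (x : R) : R := (W_mean a n x + 1 / 2) / INR (n + 1).

(** The variance of the one-variable operator: that of [W], which is
    [n x (1 + x) + a x / (1 + x)], plus that of the uniform law on a cell. *)
Definition kant_var (a : R) (n : nat) (x : R) : R :=
  (INR n * x * (1 + x) + a * x / (1 + x) + 1 / 12) / INR (n + 1) ^ 2.

Lemma W_mean_nonneg (a x : R) (n : nat) : 0 <= a -> 0 <= x -> 0 <= W_mean a n x.
Proof.
  intros Ha Hx. pose proof (pos_INR n). unfold W_mean.
  assert (0 <= a * x / (1 + x)) by (apply Rdiv_le_0_compat; nra). nra.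
Qed.

Lemma kant_mean_nonneg (a x : R) (n : nat) : 0 <= a -> 0 <= x -> 0 <= kant_mean a n x.
Proof.
  intros Ha Hx. apply Rdiv_le_0_compat; [|apply INR_n1_pos].
  pose proof (W_mean_nonneg a x n Ha Hx). lra.
Qed.

Lemma kant_mean_sub (a x : R) (n : nat) :
  kant_mean a n x - x = 1 / INR (n + 1) * (- x + a * x / (1 + x) + 1 / 2).
Proof.
  pose proof (INR_n1_pos n). unfold kant_mean, W_mean. rewrite plus_INR in *. simpl in *.
  set (t := a * x / (1 + x)). field. lra.
Qed.

Lemma W_cell_center (a x : R) (n : nat) :
  0 <= x -> is_series (fun k => W a n k x * (cell_center n k - kant_mean a n x)) 0.
Proof.
  intros Hx. pose proof (INR_n1_pos n) as HN.
  replace 0 with (/ INR (n + 1) * W_mean a n x + - (W_mean a n x / INR (n + 1)) * 1) by (field; lra).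
  apply is_series_ext_R with (fun k => / INR (n + 1) * (W a n k x * INR k)
     + - (W_mean a n x / INR (n + 1)) * W a n k x).
  - intros k. unfold cell_center, kant_mean. field. lra.
  - apply is_series_plus_R; apply is_series_scal_R; [now apply W_first_moment|now apply W_total_mass].
Qed.

Lemma W_cell_second_moment (a x : R) (n : nat) :
  0 <= x -> is_series (fun k => W a n k x * cell_second_moment n k (kant_mean a n x)) (kant_var a n x).
Proof.
  intros Hx. pose proof (INR_n1_pos n) as HN. set (N := INR (n + 1)) in *.
  set (mu := W_mean a n x).
  replace (kant_var a n x) with (/ N ^ 2 * (mu ^ 2 + INR n * x ^ 2)
     + ((1 - 2 * mu) / N ^ 2 * mu + (mu ^ 2 + 1 / 12) / N ^ 2 * 1)).
  - apply is_series_ext_R with (fun k => / N ^ 2 * (W a n k x * (INR k * (INR k - 1)))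
     + ((1 - 2 * mu) / N ^ 2 * (W a n k x * INR k) + (mu ^ 2 + 1 / 12) / N ^ 2 * W a n k x)).
    + intros k. unfold cell_second_moment, cell_center, kant_mean. fold N mu. field. lra.
    + repeat apply is_series_plus_R; apply is_series_scal_R;
        [now apply W_second_factorial_moment|now apply W_first_moment|now apply W_total_mass].
  - unfold kant_var. fold N. unfold mu, W_mean. set (t := a * x / (1 + x)). field. lra.
Qed.

Lemma kant_var_le (a x : R) (n : nat) :
  0 <= a -> 0 <= x -> kant_var a n x <= delta a n x ^ 2 / INR (n + 1).
Proof.
  intros Ha Hx. pose proof (INR_n1_pos n) as HN.
  assert (H0 : 0 <= (1 + a) ^ 2 / INR (n + 1)) by (apply Rdiv_le_0_compat; nra).
  unfold delta. rewrite pow2_sqrt by nra.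
  assert (Ht : 0 <= a * x / (1 + x) <= a).
  { split; [apply Rdiv_le_0_compat; nra|].
    apply (Rmult_le_reg_r (1 + x)); [lra|]. field_simplify; [nra|lra]. }
  unfold kant_var. set (t := a * x / (1 + x)) in *.
  assert (En : INR (n + 1) = INR n + 1) by (rewrite plus_INR; reflexivity).
  replace ((x * (1 + x) + (1 + a) ^ 2 / INR (n + 1)) / INR (n + 1))
    with ((INR (n + 1) * (x * (1 + x)) + (1 + a) ^ 2) / INR (n + 1) ^ 2) by (field; lra).
  apply Rmult_le_compat_r; [left; apply Rinv_0_lt_compat; nra|].
  rewrite En. nra.
Qed.

Definition kant1 (a : R) (n : nat) (x : R) (phi : R -> R) : R :=
  Series (fun k => W a n k x * cell_average n k phi).

Section Kant1.
Variables (a x : R) (n : nat).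
Hypotheses (Ha : 0 <= a) (Hx : 0 <= x).

(** The one-variable form of the approximation argument: a first-order expansion
    about the mean of the operator loses its linear term. *)
Lemma kant1_bound (phi : R -> R) (A B C D : R) :
  (forall t, continuous phi t) ->
  (forall u, 0 <= u -> Rabs (phi u - A - B * (u - kant_mean a n x)) <= D + C * (u - kant_mean a n x) ^ 2) ->
  ex_series (fun k => W a n k x * cell_average n k phi) /\
  Rabs (kant1 a n x phi - A) <= D + C * kant_var a n x.
Proof.
  intros Hphi Hb.
  apply weighted_sum_bound with (B := B) (c := fun k => cell_center n k - kant_mean a n x)
    (d := fun k => cell_second_moment n k (kant_mean a n x)).
  - intros k. now apply W_nonneg.
  - now apply W_total_mass.
  - now apply W_cell_center.
  - now apply W_cell_second_moment.
  - intros k. now apply cell_average_bound.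
Qed.

Lemma kant1_bounded (phi : R -> R) (D : R) :
  (forall t, continuous phi t) -> (forall u, 0 <= u -> Rabs (phi u) <= D) ->
  ex_series (fun k => W a n k x * cell_average n k phi) /\ Rabs (kant1 a n x phi) <= D.
Proof.
  intros Hphi Hb. destruct (kant1_bound phi 0 0 0 D Hphi) as [H1 H2].
  - intros u Hu. replace (_ - _ - _) with (phi u) by ring. rewrite Rmult_0_l, Rplus_0_r. auto.
  - rewrite Rminus_0_r, Rmult_0_l, Rplus_0_r in H2. auto.
Qed.

Lemma cell_average_lin (k : nat) (f g h : R -> R) (c : R) :
  (forall t, continuous f t) -> (forall t, continuous g t) -> (forall t, continuous h t) ->
  cell_average n k (fun v => f v - g v - c * h v) = cell_average n k f - cell_average n k g - c * cell_average n k h.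
Proof.
  intros Hf Hg Hh. unfold cell_average.
  set (p := node n k). set (q := node n (k + 1)).
  assert (I1 := RInt_correct (V := R_CompleteNormedModule) f p q (ex_RInt_cont _ _ _ Hf)).
  assert (I2 := RInt_correct (V := R_CompleteNormedModule) g p q (ex_RInt_cont _ _ _ Hg)).
  assert (I3 := RInt_correct (V := R_CompleteNormedModule) h p q (ex_RInt_cont _ _ _ Hh)).
  assert (I := is_RInt_minus (V := R_NormedModule) _ _ _ _ _ _
     (is_RInt_minus (V := R_NormedModule) _ _ _ _ _ _ I1 I2)
     (is_RInt_scal (V := R_NormedModule) _ _ _ c _ I3)).
  apply (is_RInt_unique (V := R_CompleteNormedModule)) in I.
  change (RInt (fun v => f v - g v - c * h v) p q = RInt f p q - RInt g p q - c * RInt h p q) in I.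
  rewrite I. ring.
Qed.

Lemma kant1_lin (f g h : R -> R) (c : R) :
  (forall t, continuous f t) -> (forall t, continuous g t) -> (forall t, continuous h t) ->
  (exists D, forall u, Rabs (f u) <= D) -> (exists D, forall u, Rabs (g u) <= D) ->
  (exists D, forall u, Rabs (h u) <= D) ->
  kant1 a n x (fun v => f v - g v - c * h v)
  = kant1 a n x f - kant1 a n x g - c * kant1 a n x h.
Proof.
  intros Hf Hg Hh [D1 B1] [D2 B2] [D3 B3].
  destruct (kant1_bounded f D1 Hf ltac:(auto)) as [S1 _].
  destruct (kant1_bounded g D2 Hg ltac:(auto)) as [S2 _].
  destruct (kant1_bounded h D3 Hh ltac:(auto)) as [S3 _].
  apply Series_correct in S1, S2, S3.
  apply is_series_unique.
  replace (_ - _ - _) with (kant1 a n x f + ((-1) * kant1 a n x g + (- c) * kant1 a n x h)) by ring.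
  eapply is_series_ext_R.
  2: { apply is_series_plus_R; [exact S1|]. apply is_series_plus_R; apply is_series_scal_R; [exact S2|exact S3]. }
  intros k. simpl. rewrite cell_average_lin by auto. ring.
Qed.
End Kant1.

(** * The operator on the quadrant *)

Lemma BUC_cell_average (n k : nat) (F : R -> R -> R) :
  BUC F -> BUC (fun v x => cell_average n k (fun u => F u v)).
Proof.
  intros HF. pose proof (INR_n1_pos n) as HN.
  assert (Hpq : node n k <= node n (k + 1)).
  { unfold node. apply Rmult_le_compat_r; [left; now apply Rinv_0_lt_compat|].
    apply le_INR. lia. }
  pose proof (BUC_RInt (fun v u => F u v) _ _ (BUC_swap _ HF) Hpq) as [[B HB] HU].
  assert (E : forall v, cell_average n k (fun u => F u v)
     = INR (n + 1) * RInt (fun s => F (0 + s) v) (node n k) (node n (k + 1))).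
  { intros v. unfold cell_average. f_equal. apply (RInt_ext (V := R_CompleteNormedModule)).
    intros s _. now rewrite Rplus_0_l. }
  apply (BUC_eq (fun v x => INR (n + 1) * RInt (fun s => F (0 + s) v) (node n k) (node n (k + 1)) + 0 * 0)).
  { intros v _. rewrite E. ring. }
  apply (BUC_lincomb (INR (n + 1)) 0 (fun v _ => RInt (fun s => F (0 + s) v) (node n k) (node n (k + 1)))
    (fun _ _ => 0)); [|apply BUC_const].
  split.
  - exists B. intros v _. apply HB.
  - intros eps He. destruct (HU eps He) as [eta [Heta H]]. exists eta. split; auto.
    intros u _ v _ Hu _. apply H; auto. rewrite Rminus_diag_eq, Rabs_R0; auto.
Qed.

Lemma node_nonneg (n k : nat) : 0 <= node n k.
Proof. apply Rdiv_le_0_compat; [apply pos_INR|apply INR_n1_pos]. Qed.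

(** The double series as the operator in [y] inside a sum over the cells of the
    first variable; the order of the two summations and of the two integrations
    is kept, so no Fubini theorem enters. *)
Lemma Kant_iterated (a : R) (n1 n2 : nat) (f : R -> R -> R) (x y : R) :
  CB f ->
  Kant a n1 n2 f x y =
  Series (fun k1 => W a n1 k1 x *
    kant1 a n2 y (fun v => cell_average n1 k1 (fun u => ext f u v))).
Proof.
  intros Hf. pose proof (BUC_ext f Hf) as HF. unfold Kant.
  rewrite <- Series_scal_l. apply Series_ext. intros k1.
  unfold kant1. rewrite <- !Series_scal_l. apply Series_ext. intros k2.
  assert (Hnode : forall n k, node n k <= node n (k + 1)).
  { intros n k. unfold node. apply Rmult_le_compat_r; [left; apply Rinv_0_lt_compat, INR_n1_pos|].
    apply le_INR. lia. }
  assert (E : RInt (fun v => RInt (fun u => f u v) (node n1 k1) (node n1 (k1 + 1)))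
         (node n2 k2) (node n2 (k2 + 1)) =
     RInt (fun v => RInt (fun u => ext f u v) (node n1 k1) (node n1 (k1 + 1)))
         (node n2 k2) (node n2 (k2 + 1))).
  { apply (RInt_ext (V := R_CompleteNormedModule)). intros v Hv.
    rewrite Rmin_left, Rmax_right in Hv by apply Hnode.
    apply (RInt_ext (V := R_CompleteNormedModule)). intros u Hu.
    rewrite Rmin_left, Rmax_right in Hu by apply Hnode.
    pose proof (node_nonneg n1 k1). pose proof (node_nonneg n2 k2).
    symmetry. apply ext_inI. split; lra. }
  rewrite E. unfold cell_average at 1.
  assert (Hc : forall t, continuous (fun v => cell_average n1 k1 (fun u => ext f u v)) t).
  { intros t. exact (BUC_continuous_l _ (BUC_cell_average n1 k1 _ HF) t 0). }
  assert (E2 : RInt (fun v => RInt (fun u => ext f u v) (node n1 k1) (node n1 (k1 + 1)))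
         (node n2 k2) (node n2 (k2 + 1))
     = / INR (n1 + 1) * RInt (fun v => cell_average n1 k1 (fun u => ext f u v))
         (node n2 k2) (node n2 (k2 + 1))).
  { pose proof (INR_n1_pos n1).
    etransitivity; [|apply (RInt_scal (V := R_CompleteNormedModule)); now apply ex_RInt_cont].
    apply (RInt_ext (V := R_CompleteNormedModule)). intros v _. unfold cell_average.
    change (RInt (fun u => ext f u v) (node n1 k1) (node n1 (k1 + 1)) = / INR (n1 + 1) *
      (INR (n1 + 1) * RInt (fun u => ext f u v) (node n1 k1) (node n1 (k1 + 1)))).
    rewrite <- Rmult_assoc, Rinv_l, Rmult_1_l by lra. reflexivity. }
  rewrite E2. pose proof (INR_n1_pos n1). field. lra.
Qed.

(** Expanding in the first variable about its mean, with the second variable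
    frozen, turns [K f] into the one-variable operator applied to [g (m1, .)]; a
    second expansion handles that one.  The mixed derivative of [g] never appears,
    since [g_x (m1, v)] is multiplied by a factor depending on the first variable
    only, whose mean is zero. *)
Lemma Kant_estimate (a : R) (n1 n2 : nat) (f g : R -> R -> R) (x y : R) :
  0 <= a -> CB f -> CB2 g -> inI x y ->
  Rabs (Kant a n1 n2 f x y - f (kant_mean a n1 x) (kant_mean a n2 y))
  <= 2 * normCB (fun u v => f u v - g u v)
     + normCB (partialI 2 0 g) * kant_var a n1 x + normCB (partialI 0 2 g) * kant_var a n2 y.
Proof.
  intros Ha Hf Hg [Hx Hy].
  set (m1 := kant_mean a n1 x). set (m2 := kant_mean a n2 y).
  assert (Hm1 : 0 <= m1) by now apply kant_mean_nonneg.
  assert (Hm2 : 0 <= m2) by now apply kant_mean_nonneg.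
  set (D := normCB (fun u v => f u v - g u v)).
  set (C1 := normCB (partialI 2 0 g)). set (C2 := normCB (partialI 0 2 g)).
  set (g1 := partialI 1 0 g).
  assert (HD : forall u v, inI u v -> Rabs (f u v - g u v) <= D).
  { intros u v Huv. apply (normCB_upper (fun u v => f u v - g u v)); auto.
    destruct Hf as [[B1 H1] _]. destruct (CB2_CB g Hg 0 0 ltac:(lia) ltac:(lia)) as [[B2 H2] _].
    exists (B1 + B2). intros s t Hst. unfold Rminus. eapply Rle_trans; [apply Rabs_triang|].
    rewrite Rabs_Ropp. apply Rplus_le_compat; [apply H1|apply (H2 s t)]; auto. }
  assert (BF : BUC (ext f)) by now apply BUC_ext.
  assert (BG : BUC (ext g)) by (apply BUC_ext, (CB2_CB g Hg 0 0); lia).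
  assert (BG1 : BUC (ext g1)) by (apply BUC_ext, (CB2_CB g Hg 1 0); lia).
  (* The expansion is of [g], but it is stated for [f] with the error [D] included. *)
  assert (HT : forall u v, 0 <= u -> 0 <= v ->
    Rabs (ext f u v - ext g m1 v - ext g1 m1 v * (u - m1)) <= D + C1 * (u - m1) ^ 2).
  { intros u v Hu Hv. rewrite !ext_inI by (split; auto).
    pose proof (deriv_nonneg_taylor (fun u => partialI 0 0 g u v) (fun u => partialI 1 0 g u v)
      (fun u => partialI 2 0 g u v) C1 m1 u
      (fun t Ht => CB2_dx g Hg 0 t v ltac:(lia) (conj Ht Hv))
      (fun t Ht => CB2_dx g Hg 1 t v ltac:(lia) (conj Ht Hv))
      (fun t Ht => CB2_upper g Hg 2 0 t v ltac:(lia) ltac:(lia) (conj Ht Hv)) Hm1 Hu) as T.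
    change (Rabs (g u v - g m1 v - g1 m1 v * (u - m1)) <= C1 * (u - m1) ^ 2) in T.
    pose proof (HD u v (conj Hu Hv)) as T2.
    apply Rabs_le_between in T, T2. apply Rabs_le. lra. }
  set (e0 := kant1 a n2 y (ext g m1)). set (e1 := kant1 a n2 y (ext g1 m1)).
  assert (H1 : Rabs (Kant a n1 n2 f x y - e0) <= D + C1 * kant_var a n1 x).
  { rewrite Kant_iterated by auto.
    apply weighted_sum_bound with (B := e1) (c := fun k => cell_center n1 k - m1)
      (d := fun k => cell_second_moment n1 k m1).
    - intros k. now apply W_nonneg.
    - now apply W_total_mass.
    - now apply W_cell_center.
    - now apply W_cell_second_moment.
    - intros k. set (psi := fun v => cell_average n1 k (fun u => ext f u v)).
      set (c := cell_center n1 k - m1).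
      assert (Bpsi := BUC_cell_average n1 k _ BF).
      assert (Cpsi : forall t, continuous psi t)
        by (intros t; exact (BUC_continuous_l _ Bpsi t 0)).
      (* The inner operator is linear, so its value at the difference of [psi] and the
         expansion is what has to be bounded. *)
      rewrite (Rmult_comm e1). unfold e0, e1.
      rewrite <- kant1_lin; auto; try (now apply BUC_continuous).
      + apply kant1_bounded; auto.
        * intros t. apply (continuous_minus (fun v => psi v - ext g m1 v) (fun v => c * ext g1 m1 v)).
          -- apply (continuous_minus psi (ext g m1)); auto. now apply BUC_continuous.
          -- apply (continuous_scal_r c (ext g1 m1)). now apply BUC_continuous.
        * intros v Hv. rewrite (Rmult_comm c). apply cell_average_bound.
          -- intros t. now apply BUC_continuous_l.
          -- intros u Hu. now apply HT.
      + destruct Bpsi as [[B HB] _]. exists B. intros u. apply (HB u 0).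
      + destruct BG as [[B HB] _]. exists B. auto.
      + destruct BG1 as [[B HB] _]. exists B. auto. }
  assert (H2 : Rabs (e0 - g m1 m2) <= 0 + C2 * kant_var a n2 y).
  { apply (kant1_bound a y n2 Ha Hy (ext g m1) (g m1 m2) (partialI 0 1 g m1 m2) C2 0).
    - intros t. now apply BUC_continuous.
    - intros v Hv. rewrite ext_inI by (now split). rewrite Rplus_0_l.
      apply (deriv_nonneg_taylor (fun v => partialI 0 0 g m1 v) (fun v => partialI 0 1 g m1 v)
        (fun v => partialI 0 2 g m1 v)); auto; intros t Ht.
      + now apply CB2_dy; [|lia|split].
      + now apply CB2_dy; [|lia|split].
      + now apply CB2_upper; [|lia|lia|split]. }
  pose proof (HD m1 m2 (conj Hm1 Hm2)) as H3.
  apply Rabs_le_between in H1, H2, H3. apply Rabs_le. lra.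
Qed.

Lemma Mn_pos (a : R) (n1 n2 : nat) (x y : R) : 0 <= a -> inI x y -> 0 < Mn a n1 n2 x y.
Proof.
  intros Ha [Hx Hy].
  assert (D : forall n z, 0 <= z -> 0 < delta a n z ^ 2 / INR (n + 1)).
  { intros n z Hz. pose proof (INR_n1_pos n).
    assert (0 < (1 + a) ^ 2 / INR (n + 1)) by (apply Rdiv_lt_0_compat; nra).
    apply Rdiv_lt_0_compat; auto. unfold delta. rewrite pow2_sqrt; nra. }
  unfold Mn. pose proof (D n1 x Hx). pose proof (D n2 y Hy). lra.
Qed.

Theorem theorem1 :
  forall a : R, 0 <= a ->
  exists M : R, 0 <= M /\
  forall (f : R -> R -> R), CB f ->
  forall x y : R, inI x y ->
  forall n1 n2 : nat, (1 <= n1)%nat -> (1 <= n2)%nat ->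
    Rabs (Kant a n1 n2 f x y - f x y)
      <= 4 * Kfunctional f (Mn a n1 n2 x y) + omega f (rho a n1 n2 x y)
    /\
    4 * Kfunctional f (Mn a n1 n2 x y) + omega f (rho a n1 n2 x y)
      <= M * (omega2 f (sqrt (Mn a n1 n2 x y))
              + Rmin 1 (Mn a n1 n2 x y) * normCB f)
         + omega f (rho a n1 n2 x y).
Proof.
  (* 448 = 4 * 112, the constant of [Kfunctional_le_omega2] times 4 *)
  intros a Ha. exists 448. split; [lra|].
  intros f Hf x y Hxy n1 n2 _ _.
  pose proof (Mn_pos a n1 n2 x y Ha Hxy) as HM. split.
  2: { pose proof (Kfunctional_le_omega2 f _ Hf HM). lra. }
  destruct Hxy as [Hx Hy].
  set (m1 := kant_mean a n1 x). set (m2 := kant_mean a n2 y).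
  assert (Hom : Rabs (f m1 m2 - f x y) <= omega f (rho a n1 n2 x y)).
  { apply omega_upper; [apply Hf| | |].
    - split; now apply kant_mean_nonneg.
    - now split.
    - unfold m1, m2. rewrite !kant_mean_sub. apply Rle_refl. }
  assert (HK : Rabs (Kant a n1 n2 f x y - f m1 m2) / 4 <= Kfunctional f (Mn a n1 n2 x y)).
  { apply infR_greatest.
    - eexists. exists (fun _ _ => 0). split; [apply CB2_0|reflexivity].
    - intros s (g & Hg & ->).
      pose proof (Kant_estimate a n1 n2 f g x y Ha Hf Hg (conj Hx Hy)) as HE.
      pose proof (normCB_nonneg g). pose proof (normCB_nonneg (partialI 1 0 g)).
      pose proof (normCB_nonneg (partialI 2 0 g)). pose proof (normCB_nonneg (partialI 0 1 g)).
      pose proof (normCB_nonneg (partialI 0 2 g)).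
      pose proof (normCB_nonneg (fun u v => f u v - g u v)).
      assert (L1 : normCB (partialI 2 0 g) * kant_var a n1 x
         <= normCB2 g * (delta a n1 x ^ 2 / INR (n1 + 1))).
      { apply Rle_trans with (normCB (partialI 2 0 g) * (delta a n1 x ^ 2 / INR (n1 + 1))).
        - apply Rmult_le_compat_l; auto. now apply kant_var_le.
        - apply Rmult_le_compat_r; [|unfold normCB2; lra].
          apply Rdiv_le_0_compat; [apply pow2_ge_0|apply INR_n1_pos]. }
      assert (L2 : normCB (partialI 0 2 g) * kant_var a n2 y
         <= normCB2 g * (delta a n2 y ^ 2 / INR (n2 + 1))).
      { apply Rle_trans with (normCB (partialI 0 2 g) * (delta a n2 y ^ 2 / INR (n2 + 1))).
        - apply Rmult_le_compat_l; auto. now apply kant_var_le.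
        - apply Rmult_le_compat_r; [|unfold normCB2; lra].
          apply Rdiv_le_0_compat; [apply pow2_ge_0|apply INR_n1_pos]. }
      assert (L3 : normCB2 g * (delta a n1 x ^ 2 / INR (n1 + 1))
         + normCB2 g * (delta a n2 y ^ 2 / INR (n2 + 1)) = Mn a n1 n2 x y * normCB2 g)
        by (unfold Mn; ring).
      pose proof (Rmult_le_pos _ _ (Rlt_le _ _ HM) (normCB2_nonneg g)).
      fold m1 m2 in HE. lra. }
  replace (Kant a n1 n2 f x y - f x y)
    with ((Kant a n1 n2 f x y - f m1 m2) + (f m1 m2 - f x y)) by ring.
  eapply Rle_trans; [apply Rabs_triang|]. lra.
Qed.
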